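(* Let $n\ge 2$. Consider the embedding $$\frac{\mathrm{SO}(2n)}{\mathrm{U}(1)\times \mathrm{U}(n-1)}\hookrightarrow \frac{\mathrm{SO}(2n)}{\mathrm{U}(n)}\times \frac{\mathrm{SO}(2n)}{\mathrm{U}(n)}\times \frac{\mathrm{SO}(2n)}{\mathrm{SO}(2n-2)\times \mathrm{U}(1)},\qquad (x,y)\mapsto \bigl(x\oplus y,\; x\oplus y^{\ast},\; x\bigr).$$ This embedding is Lagrangian with respect to a suitable choice of symplectic form on the right-hand side; that is, one can realize each of the three factors on the right as an adjoint orbit of $\mathrm{SO}(2n)$ in such a way that the image is a Lagrangian submanifold for the sum of the Kirillov–Kostant–Souriau forms of the three factors.
   Context: $\mathrm{SO}(2n)$ is the compact real group acting on $\mathbb{C}^{2n}=\mathbb{R}^{2n}\otimes\mathbb{C}$. A linear subspace of $\mathbb{C}^{2n}$ is called isotropic if the symmetric bilinear form $(u,v)\mapsto u^t v$ vanishes on it. Orthogonality of subspaces is with respect to the standard sesquilinear product $(u,v)\mapsto u^\dagger v$. For a subspace $y$, $y^\ast$ denotes the subspace obtained by complex conjugating the vectors of $y$. The manifold $\mathrm{SO}(2n)/(\mathrm{U}(1)\times \mathrm{U}(n-1))$ describes the pairs $(x,y)$ with $x$ an isotropic line, $y$ an isotropic $(n-1)$-plane orthogonal to $x$, and $x\oplus y$ an isotropic $n$-plane (a single $\mathrm{SO}(2n)$-orbit of such pairs). The manifold $\mathrm{SO}(2n)/\mathrm{U}(n)$ is the Grassmannian of isotropic $n$-planes in $\mathbb{C}^{2n}$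 (isotropic $n$-planes form two $\mathrm{SO}(2n)$-orbits, each isomorphic to $\mathrm{SO}(2n)/\mathrm{U}(n)$; each factor on the right is the orbit containing the corresponding component of the map). The manifold $\mathrm{SO}(2n)/(\mathrm{SO}(2n-2)\times\mathrm{U}(1))$ is the quadric of isotropic lines, $\{w^t w=0\}\subset\mathbb{CP}^{2n-1}$. The adjoint orbit of $\Lambda\in\mathfrak{so}_{2n}$ is $\{g\Lambda g^{-1}: g\in \mathrm{SO}(2n)\}$. Its Kirillov–Kostant–Souriau symplectic form at $x$ is $\omega_x(\xi,\zeta)=\langle x,[\xi,\zeta]\rangle$, where $\langle X,Y\rangle=\mathrm{Tr}(XY)$ and tangent vectors at $x$ are represented by the Lie algebra elements $\xi,\zeta$ generating them. A submanifold $L$ of a symplectic manifold $(M,\omega)$ is Lagrangian if $\omega|_L=0$ and $2\dim L=\dim M$. *)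

(* Defs.v *)
From HB Require Import structures.
From mathcomp Require Import all_boot all_order all_algebra complex.
From mathcomp Require Import boolp classical_sets functions reals.
From mathcomp Require Import topology normedtype derive.

Set Implicit Arguments.
Unset Strict Implicit.
Unset Printing Implicit Defensive.

Import Order.TTheory GRing.Theory Num.Theory.
Import numFieldNormedType.Exports.

Local Open Scope classical_set_scope.
Local Open Scope ring_scope.

Section Submanifolds.
Variable R : realType.

Fixpoint Ck (V W : normedModType R) (k : nat) (U : set V) (f : V -> W) : Prop :=
  match k with
  | 0 => forall x, U x -> {for x, continuous f}
  | k'.+1 => (forall x, U x -> differentiable f x) /\
             (forall v, Ck k' U (fun x => 'D_v f x))
  end.

(* Only used for open U. *)
Definition smooth_on (V W : normedModType R) (U : set V) (f : V -> W) : Prop :=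
  forall k, Ck k U f.

(* Embedded submanifolds of a (finite-dimensional) ambient space, after Milnor:
   every point has a neighbourhood in S diffeomorphic to an open subset W of
   R^d, smoothness of the inverse chart being that of an extension [psi] to an
   open subset U of the ambient space. *)
Definition submanifold (V : normedModType R) (d : nat) (S : set V) : Prop :=
  forall p, S p ->
  exists (W : set 'rV[R]_d) (U : set V) (phi : 'rV[R]_d -> V) (psi : V -> 'rV[R]_d),
    [/\ open W, open U & U p] /\
    [/\ smooth_on W phi, smooth_on U psi,
        phi @` W = S `&` U & forall w, W w -> psi (phi w) = w].

(* Velocities at p of curves in S. When S is a submanifold, differentiability
   at time 0 already yields exactly its tangent space at p. *)
Definition tangent (V : normedModType R) (S : set V) (p : V) : set V :=
  [set v | exists c : R -> V,
     [/\ c 0 = p, forall t, S (c t) & is_derive (0 : R) (1 : R) c v]].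

(* [om p u v] is the value at p in M of a 2-form on M on u, v tangent to M. *)
Definition lagrangian (V : normedModType R) (om : V -> V -> V -> R)
    (M L : set V) : Prop :=
  L `<=` M /\
  (exists dL dM : nat,
     [/\ submanifold dL L, submanifold dM M & (2 * dL = dM)%N]) /\
  (forall p u v, L p -> tangent L p u -> tangent L p v -> om p u v = 0).

End Submanifolds.

Section AdjointOrbits.
Variables (R : realType) (m : nat).

Definition SO : set 'M[R]_m := [set g | g *m g^T = 1%:M /\ \det g = 1].

Definition so : set 'M[R]_m := [set x | x^T = - x].

Definition lie (x y : 'M[R]_m) : 'M[R]_m := x *m y - y *m x.

Definition Ad (g x : 'M[R]_m) : 'M[R]_m := g *m x *m invmx g.

Definition adjoint_orbit (Lam : 'M[R]_m) : set 'M[R]_m :=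
  [set Ad g Lam | g in SO].

(* A Lie algebra element generating the tangent vector u at x: the
   infinitesimal adjoint action of xi at x is the bracket of xi and x. *)
Definition generator (x u : 'M[R]_m) : 'M[R]_m :=
  xget 0 [set xi | so xi /\ lie xi x = u].

(* Independent of the chosen generators, see [kks_lie]. *)
Definition kks (x u v : 'M[R]_m) : R :=
  \tr (x *m lie (generator x u) (generator x v)).

Lemma kks_lie x xi zeta : so xi -> so zeta ->
  kks x (lie xi x) (lie zeta x) = \tr (x *m lie xi zeta).
Proof.
have trE a b : \tr (x *m lie a b) = \tr (a *m lie b x).
  rewrite /lie !mulmxBr !raddfB /= [in X in X - _]mxtrace_mulC.
  by rewrite [in X in _ - X]mulmxA [in X in _ - X]mxtrace_mulC !mulmxA.
have trN a b : \tr (x *m lie a b) = - \tr (b *m lie a x).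
  by rewrite -(trE b a) /lie !mulmxBr !raddfB /= opprK addrC.
have genP a : so a -> lie (generator x (lie a x)) x = lie a x.
  move=> sa; suff [] : [set b | so b /\ lie b x = lie a x]
    (generator x (lie a x)) by [].
  by apply: xgetPex; exists a.
move=> sxi szeta.
by rewrite /kks trN genP // -trN trE genP // -trE.
Qed.

Definition kks3 (p u v : 'M[R]_m * 'M[R]_m * 'M[R]_m) : R :=
  kks p.1.1 u.1.1 v.1.1 + kks p.1.2 u.1.2 v.1.2 + kks p.2 u.2 v.2.

End AdjointOrbits.

Section Subspaces.
Variables (R : realType) (m : nat).
Local Notation vec := 'cV[R[i]]_m.

Definition conjmx (u : vec) : vec := map_mx conjc u.

Definition isotropic (z : {vspace vec}) : Prop :=
  forall u v, u \in z -> v \in z -> u^T *m v = 0.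

Definition orthogonal (x y : {vspace vec}) : Prop :=
  forall u v, u \in x -> v \in y -> (conjmx u)^T *m v = 0.

(* The subspace of all conjugates of vectors of z, see [memv_conjv]. *)
Definition conjv (z : {vspace vec}) : {vspace vec} :=
  <<[seq conjmx u | u <- vbasis z]>>%VS.

Lemma memv_conjv z v : (v \in conjv z) = (conjmx v \in z).
Proof.
have cjK u : conjmx (conjmx u) = u.
  by apply/matrixP => i j; rewrite !mxE conjcK.
have cjZ a u : conjmx (a *: u) = conjc a *: conjmx u.
  by apply/matrixP => i j; rewrite !mxE rmorphM.
have cjS I (r : seq I) (F : I -> vec) :
    conjmx (\sum_(i <- r) F i) = \sum_(i <- r) conjmx (F i).
  by apply/matrixP => i j; rewrite !(mxE, summxE) raddf_sum;
     apply: eq_bigr => k _; rewrite mxE.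
apply/idP/idP => [|zv].
  move=> /(@coord_span _ _ _ (map_tuple conjmx (vbasis z))) ->.
  rewrite cjS; apply: memv_suml => i _.
  rewrite cjZ -tnth_nth tnth_map cjK memvZ //.
  by rewrite vbasis_mem // mem_tnth.
rewrite -[v]cjK (coord_vbasis zv) cjS; apply: memv_suml => i _.
by rewrite cjZ memvZ // memv_span // map_f // mem_nth // size_tuple.
Qed.

Definition act (g : 'M[R]_m) (z : {vspace vec}) : {vspace vec} :=
  (linfun (mulmx (map_mx (real_complex R) g)) @: z)%VS.

Definition SO_orbit (z : {vspace vec}) : set {vspace vec} :=
  [set act g z | g in @SO R m].

Definition SO_orbit2 (xy : {vspace vec} * {vspace vec}) :
    set ({vspace vec} * {vspace vec}) :=
  [set (act g xy.1, act g xy.2) | g in @SO R m].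

Definition isotropic_lines : set {vspace vec} :=
  [set z | \dim z = 1 /\ isotropic z].

(* f identifies the homogeneous space F with the adjoint orbit of Lam; an
   equivariant bijection between homogeneous spaces of a compact Lie group is
   automatically a diffeomorphism. *)
Definition realization (F : set {vspace vec}) (Lam : 'M[R]_m)
    (f : {vspace vec} -> 'M[R]_m) : Prop :=
  [/\ so Lam, set_bij F (adjoint_orbit Lam) f &
      forall g z, SO g -> F z -> f (act g z) = Ad g (f z)].

End Subspaces.

Definition isotropic_pair (R : realType) (n : nat)
    (x y : {vspace 'cV[R[i]]_(2 * n)}) : Prop :=
  [/\ \dim x = 1 /\ isotropic x, \dim y = n.-1 /\ isotropic y,
      orthogonal x y &
      [/\ directv (x + y)%VS, \dim (x + y)%VS = n & isotropic (x + y)%VS]].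

Definition flag_map (R : realType) (m : nat)
    (xy : {vspace 'cV[R[i]]_m} * {vspace 'cV[R[i]]_m}) :
    {vspace 'cV[R[i]]_m} * {vspace 'cV[R[i]]_m} * {vspace 'cV[R[i]]_m} :=
  ((xy.1 + xy.2)%VS, (xy.1 + conjv xy.2)%VS, xy.1).

(* Main.v *)
From Pilot Require Import Defs.
From HB Require Import structures.
From mathcomp Require Import all_boot all_order all_algebra complex.
From mathcomp Require Import boolp classical_sets functions reals.
From mathcomp Require Import topology normedtype derive.
From mathcomp Require Import landau.
From mathcomp Require Import ring lra zify.
Import numFieldNormedType.Exports.
Import Order.TTheory GRing.Theory Num.Theory.
Local Open Scope classical_set_scope.
Local Open Scope ring_scope.

Set Implicit Arguments.
Unset Strict Implicit.
Unset Printing Implicit Defensive.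

(** Let z = x + y be the isotropic n-plane of a pair (x, y). It is the
   eigenspace for the eigenvalue i of a unique real matrix J, skew with
   J^2 = -1 ([isotropic_complex_structure]), and the line x is spanned by a + ib
   for an orthonormal pair of real vectors with b = - Ja, so that x is the same
   thing as the projector Q onto the J-complex line of a. The isotropic n-plane
   x + y^* is then the eigenspace of J2 = 2 JQ - J ([pair_eig2]), and the line x
   itself corresponds to the skew matrix J3 = - 2 JQ of rank two
   ([pair_plane]). Sending the three subspaces to J, J2 and J3 realizes the
   three factors as adjoint orbits ([relation_realization]), and the
   normalization is chosen so that

     J + J2 + J3 = 0,

   that is, the image L lies in the zero level of the moment map of the diagonal
   action. Since L is a single orbit, every tangent vector at p is generated by
   a skew matrix; for two of them, xi and zeta, the sum of the symplectic forms
   is the trace of (p1 + p2 + p3) [xi, zeta], hence zero ([flag_kks]). That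
   tangent vectors of curves in L are generated by skew matrices is a matter of
   linear algebra: one differentiates J^2 = -1, Q^2 = Q and JQ = QJ, and solves
   for the generator ([infinitesimal_generator]).

   It remains to prove that L and the three orbits are submanifolds, of
   dimensions n(n-1) + 2(n-1) for L, n(n-1) for the orbits of complex structures
   and 4(n-1) for the quadric, so that 2 dim L is the dimension of the product.
   The charts are given by rational formulas with rational inverses, so that
   smoothness reduces to the stability of smooth functions under sums,
   products and inverses:
   - near J, every complex structure of the orbit is (1 - Z)^-1 J (1 - Z) for a
     unique skew Z that anticommutes with J ([submanifold_cstruct]);
   - L is a bundle over that orbit, whose fibre over q is the projective space
     of q-complex lines; the line through (1 - Z)^-1 (w + s), with s orthogonal to
     the J-complex line of w, gives affine coordinates s on the fibre
     ([submanifold_triple]);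
   - an isotropic line close to the one of u = a + ib has a unique generator
     u + sigma - k u^* with sigma orthogonal to u and u^*, and isotropy
     determines k from sigma ([submanifold_plane]).

   That a chart stays in the SO(m)-orbit, and not only in the O(m)-orbit, is an
   orientation argument: a real matrix commuting with a complex structure has
   determinant at least 0 ([comm_det_ge0]), whereas the matrix 1 - J'J, which
   intertwines J and J', has positive determinant for the J' of the chart
   ([cs_trans_det]). *)

(** * Functions of class C^k *)

Section Smooth.
Variable R : realType.

(** Differentiability depends on the germ only: g - f is constantly zero near x,
   so that its differential is zero. *)
Lemma near_eq_differentiable (V W : normedModType R) (f g : V -> W) x :
  (\near x, f x = g x) -> differentiable f x -> differentiable g x.
Proof.
move=> fg df; have fgx := nbhs_singleton fg.
have d0 : 'd (cst (0 : W)) x = 0 :> (V -> W) by rewrite diff_cst.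
have dE : (g - f) \o shift x =
    cst ((g - f) x) + 'd (cst (0 : W)) x +o_ 0 id.
  apply/eqaddoP => e e0; near=> h.
  rewrite d0 !fctE /=.
  have -> : f (h + x) = g (h + x).
    near: h; move: fg; rewrite (near_shift 0 x) /=.
    by apply: filterS => y; rewrite /= subr0.
  by rewrite fgx !subrr !addr0 subr0 normr0 mulr_ge0 // ltW.
have c0 : continuous ('d (cst (0 : W)) x).
  by rewrite d0 => ?; apply: cst_continuous.
have -> : g = (g - f) + f by apply/funext => y; rewrite !fctE subrK.
apply: differentiableD df; apply/diff_locallyP.
by rewrite (diff_unique c0 dE).
Unshelve. all: by end_near.
Qed.

(** On an open set the iterated directional derivatives depend only on the
   values there. Hence the product, chain and inversion rules, which only hold
   on U, can be used inside the recursive definition of [Ck]. *)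
Lemma Ck_ext (V W : normedModType R) k (U : set V) (f g : V -> W) :
  open U -> (forall x, U x -> f x = g x) -> Ck k U f -> Ck k U g.
Proof.
move=> oU.
have nE (h l : V -> W) x : U x -> (forall x, U x -> h x = l x) ->
    \near x, h x = l x.
  by move=> Ux hl; apply: filterS (open_nbhs_nbhs (conj oU Ux)) => y; apply: hl.
elim: k f g => [|k IH] f g fg /=.
  move=> cf x Ux; rewrite /prop_for /continuous_at -fg //.
  apply: cvg_trans (cf x Ux); apply: near_eq_cvg; exact: nE.
case=> df Df; split => [x Ux|v].
  by apply: near_eq_differentiable (df x Ux); apply: nE.
apply: (IH (fun x => 'D_v f x)) (Df v) => x Ux.
by apply: near_eq_derive; apply: nE.
Qed.

Lemma CkS (V W : normedModType R) k (U : set V) (f : V -> W) :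
  Ck k.+1 U f -> Ck k U f.
Proof.
elim: k f => [|k IH] f [df Df].
  by move=> x Ux; apply: differentiable_continuous; apply: df.
by split => // v; apply: IH; apply: Df.
Qed.

Lemma Ck_subset (V W : normedModType R) k (U U' : set V) (f : V -> W) :
  U' `<=` U -> Ck k U f -> Ck k U' f.
Proof.
move=> sU; elim: k f => [|k IH] f /=; first by move=> cf x /sU; apply: cf.
by case=> df Df; split => [x /sU/df//|v]; apply: IH.
Qed.

Lemma Ck_cst (V W : normedModType R) k (U : set V) (a : W) :
  Ck k U (fun _ : V => a).
Proof.
elim: k a => [|k IH] a /=; first by move=> x _; apply: cst_continuous.
split=> [x _|v]; first exact: differentiable_cst.
suff -> : (fun x : V => 'D_v (fun=> a) x) = fun=> 0 by apply: IH.
by rewrite funeqE => x; rewrite derive_cst.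
Qed.

Lemma Ck_add (V W : normedModType R) k (U : set V) (f g : V -> W) :
  open U -> Ck k U f -> Ck k U g -> Ck k U (fun x => f x + g x).
Proof.
move=> oU; elim: k f g => [|k IH] f g /=.
  by move=> cf cg x Ux; apply: cvgD; [apply: cf|apply: cg].
move=> [df Df] [dg Dg]; split=> [x Ux|v].
  by apply: differentiableD; [apply: df|apply: dg].
apply: Ck_ext oU _ (IH _ _ (Df v) (Dg v)) => x Ux.
by rewrite -deriveD //; apply: diff_derivable; auto.
Qed.

Lemma Ck_post (V W W' : normedModType R) k (U : set V) (f : V -> W)
  (l : {linear W -> W'}) : open U -> continuous l -> Ck k U f ->
  Ck k U (fun x => l (f x)).
Proof.
move=> oU cl; elim: k f => [|k IH] f /=.
  by move=> cf x Ux; apply: continuous_comp; [apply: cf|apply: cl].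
move=> [df Df]; split=> [x Ux|v].
  by apply: differentiable_comp; [exact: df|exact: linear_differentiable].
apply: Ck_ext oU _ (IH _ (Df v)) => x Ux.
have dl := linear_differentiable (f x) cl.
rewrite deriveE; last exact: df.
rewrite -[fun x => _]/(l \o f) deriveE; last first.
  by apply: differentiable_comp => //; exact: df.
rewrite (diff_comp (df x Ux) dl) /=.
by rewrite (diff_lin _ cl).
Qed.

Lemma Ck_pre (V V' W : normedModType R) k (U : set V) (f : V -> W)
  (l : {linear V' -> V}) : open U -> continuous l -> Ck k U f ->
  Ck k (l @^-1` U) (fun x => f (l x)).
Proof.
move=> oU cl.
have oU' : open (l @^-1` U) by apply: open_comp => // x _; apply: cl.
elim: k f => [|k IH] f /=.
  by move=> cf x Ux; apply: continuous_comp; [apply: cl|apply: cf].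
move=> [df Df]; split=> [x Ux|v].
  by apply: differentiable_comp; [exact: linear_differentiable|exact: df].
apply: Ck_ext oU' _ (IH _ (Df (l v))) => x Ux.
have dl := linear_differentiable x cl.
rewrite deriveE; last exact: df.
rewrite -[fun x => _]/(f \o l) deriveE; last first.
  by apply: differentiable_comp => //; exact: df.
rewrite (diff_comp dl (df _ Ux)) /=.
by rewrite (diff_lin _ cl).
Qed.

Lemma Ck_mul (V : normedModType R) k (U : set V) (f g : V -> R) :
  open U -> Ck k U f -> Ck k U g -> Ck k U (fun x => f x * g x).
Proof.
move=> oU; elim: k f g => [|k IH] f g.
  by move=> cf cg x Ux; apply: cvgM; [apply: cf|apply: cg].
move=> Cf Cg; have [df Df] := Cf; have [dg Dg] := Cg; split=> [x Ux|v].
  by apply: differentiableM; [apply: df|apply: dg].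
apply: (Ck_ext (f := fun x => f x * 'D_v g x + g x * 'D_v f x) oU).
  move=> x Ux.
  rewrite -[RHS]/('D_v (f * g) x) deriveM //; apply: diff_derivable.
    exact: df.
  exact: dg.
have [Cf' Cg'] := (CkS Cf, CkS Cg).
by apply: Ck_add oU _ _; apply: IH => //; [exact: Dg|exact: Df].
Qed.

Lemma Ck_inv (V : normedModType R) k (U : set V) (f : V -> R) :
  open U -> (forall x, U x -> f x != 0) -> Ck k U f ->
  Ck k U (fun x => (f x)^-1).
Proof.
move=> oU f0; elim: k => [|k IH].
  by move=> cf x Ux; apply: cvgV; [apply: f0|apply: cf].
move=> Cf; have [df Df] := Cf; have Ci := IH (CkS Cf); split=> [x Ux|v].
  by apply: differentiableV; [apply: df|apply: f0].
apply: (Ck_ext (f := fun x => -1 * ((f x)^-1 * (f x)^-1) * 'D_v f x) oU).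
  move=> x Ux.
  rewrite deriveV ?f0 //; last by apply: diff_derivable; apply: df.
  by rewrite mulN1r -invfM -expr2.
apply: Ck_mul (Df v) => //; apply: Ck_mul => //; first exact: Ck_cst.
exact: Ck_mul.
Qed.

Lemma Ck_sum (V W : normedModType R) k (U : set V) I (r : seq I)
   (P : pred I) (f : I -> V -> W) :
  open U -> (forall i, Ck k U (f i)) ->
  Ck k U (fun x => \sum_(i <- r | P i) f i x).
Proof.
move=> oU Cf; elim: r => [|i r IH].
  by apply: (Ck_ext oU _ (@Ck_cst _ _ k U 0)) => x _; rewrite big_nil.
have [Pi|Pi] := boolP (P i).
  by apply: (Ck_ext oU _ (Ck_add oU (Cf i) IH)) => x _; rewrite big_cons Pi.
by apply: (Ck_ext oU _ IH) => x _; rewrite big_cons (negbTE Pi).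
Qed.

Lemma Ck_prod (V : normedModType R) k (U : set V) I (r : seq I)
   (P : pred I) (f : I -> V -> R) :
  open U -> (forall i, Ck k U (f i)) ->
  Ck k U (fun x => \prod_(i <- r | P i) f i x).
Proof.
move=> oU Cf; elim: r => [|i r IH].
  by apply: (Ck_ext oU _ (@Ck_cst V R k U 1)) => x _; rewrite big_nil.
have [Pi|Pi] := boolP (P i).
  by apply: (Ck_ext oU _ (Ck_mul oU (Cf i) IH)) => x _; rewrite big_cons Pi.
by apply: (Ck_ext oU _ IH) => x _; rewrite big_cons (negbTE Pi).
Qed.

Lemma continuous_linear_mx (W : normedModType R) a b
  (l : {linear 'M[R]_(a, b) -> W}) : continuous l.
Proof.
have -> : (l : _ -> _) = fun M => \sum_i \sum_j M i j *: l (delta_mx i j).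
  rewrite funeqE => M; rewrite {1}(matrix_sum_delta M) linear_sum.
  by apply: eq_bigr => i _; rewrite linear_sum; apply: eq_bigr => j _; rewrite linearZ.
suff C0 : Ck 0 setT (fun M : 'M[R]_(a, b) =>
    \sum_i \sum_j M i j *: l (delta_mx i j)) by move=> M; apply: C0.
apply: Ck_sum => [|i]; first exact: openT.
apply: Ck_sum => [|j]; first exact: openT.
move=> M _; have cM : (N i j @[N --> M] --> M i j)%classic by exact: coord_continuous.
exact: (@cvgZr_tmp _ _ _ _ _ _ _ (l (delta_mx i j)) cM).
Qed.

Lemma Ck_entry (V : normedModType R) a b k (U : set V) (f : V -> 'M[R]_(a, b)) i j :
  open U -> Ck k U f -> Ck k U (fun x => f x i j).
Proof.
move=> oU Cf.
have lin : linear (fun M : 'M[R]_(a, b) => M i j : R).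
  by move=> c x y; rewrite !mxE.
pose lM := GRing.isLinear.Build _ _ _ _ _ lin.
pose l : {linear _ -> _} := HB.pack (fun M : 'M[R]_(a, b) => M i j : R) lM.
by apply: (Ck_post (l := l)) oU (@continuous_linear_mx _ _ _ _) Cf.
Qed.

(** A matrix-valued function is the sum of its entries times the elementary
   matrices, so that C^k can be tested entrywise. *)
Lemma Ck_mx (V : normedModType R) a b k (U : set V) (f : V -> 'M[R]_(a, b)) :
  open U -> (forall i j, Ck k U (fun x => f x i j)) -> Ck k U f.
Proof.
move=> oU Cf.
apply: (Ck_ext (f := fun x => \sum_i \sum_j f x i j *: delta_mx i j) oU).
  by move=> x _; rewrite -matrix_sum_delta.
apply: Ck_sum => // i; apply: Ck_sum => // j.
have lin : linear (fun r : R => r *: delta_mx i j : 'M[R]_(a, b)).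
  by move=> c x y; rewrite scalerDl scalerA.
pose lM := GRing.isLinear.Build _ _ _ _ _ lin.
pose l : {linear _ -> _} := HB.pack (fun r : R => r *: delta_mx i j : 'M[R]_(a, b)) lM.
apply: (Ck_post (l := l)) oU _ (Cf i j) => x.
have cx : (r @[r --> x] --> x)%classic by exact: cvg_id.
exact: (@cvgZr_tmp _ _ _ _ _ _ _ (delta_mx i j) cx).
Qed.

End Smooth.

(** * Smooth maps between spaces of matrices *)

Section SmoothOn.
Variables (R : realType) (V : normedModType R) (U : set V).
Hypothesis oU : open U.

Lemma smooth_cst (W : normedModType R) (a : W) : smooth_on U (fun=> a).
Proof. by move=> k; apply: Ck_cst. Qed.

Lemma smooth_id : smooth_on U id.
Proof.
case=> [|k]; first by move=> x _; apply: cvg_id.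
split=> [x _|v]; first exact: ex_diff.
by apply: (Ck_ext oU _ (@Ck_cst R V V k U v)) => x _; rewrite derive_id.
Qed.

Lemma smooth_lin (W W' : normedModType R) (l : {linear W -> W'}) (f : V -> W) :
  continuous l -> smooth_on U f -> smooth_on U (fun x => l (f x)).
Proof. by move=> cl sf k; apply: Ck_post. Qed.

Lemma smooth_add (W : normedModType R) (f g : V -> W) :
  smooth_on U f -> smooth_on U g -> smooth_on U (fun x => f x + g x).
Proof. by move=> sf sg k; apply: Ck_add. Qed.

Lemma smooth_mul (f g : V -> R) :
  smooth_on U f -> smooth_on U g -> smooth_on U (fun x => f x * g x).
Proof. by move=> sf sg k; apply: Ck_mul. Qed.

Lemma smooth_inv (f : V -> R) : (forall x, U x -> f x != 0) ->
  smooth_on U f -> smooth_on U (fun x => (f x)^-1).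
Proof. by move=> f0 sf k; apply: Ck_inv. Qed.

Lemma smooth_sum (W : normedModType R) I (r : seq I) (P : pred I)
   (f : I -> V -> W) : (forall i, smooth_on U (f i)) ->
  smooth_on U (fun x => \sum_(i <- r | P i) f i x).
Proof. by move=> sf k; apply: Ck_sum => // i; apply: sf. Qed.

Lemma smooth_prod I (r : seq I) (P : pred I) (f : I -> V -> R) :
  (forall i, smooth_on U (f i)) ->
  smooth_on U (fun x => \prod_(i <- r | P i) f i x).
Proof. by move=> sf k; apply: Ck_prod => // i; apply: sf. Qed.

Lemma smooth_ext (W : normedModType R) (f g : V -> W) :
  (forall x, U x -> f x = g x) -> smooth_on U f -> smooth_on U g.
Proof. by move=> fg sf k; apply: Ck_ext (sf k). Qed.

Lemma smooth_entry a b (f : V -> 'M[R]_(a, b)) i j :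
  smooth_on U f -> smooth_on U (fun x => f x i j).
Proof. by move=> sf k; apply: Ck_entry. Qed.

Lemma smooth_mx a b (f : V -> 'M[R]_(a, b)) :
  (forall i j, smooth_on U (fun x => f x i j)) -> smooth_on U f.
Proof. by move=> sf k; apply: Ck_mx => // i j; apply: sf. Qed.

Lemma smooth_opp a b (f : V -> 'M[R]_(a, b)) :
  smooth_on U f -> smooth_on U (fun x => - f x).
Proof. by apply: smooth_lin; apply: continuous_linear_mx. Qed.

Lemma smooth_trmx a b (f : V -> 'M[R]_(a, b)) :
  smooth_on U f -> smooth_on U (fun x => (f x)^T).
Proof. by apply: smooth_lin; apply: continuous_linear_mx. Qed.

Lemma smooth_scale a b (c : V -> R) (f : V -> 'M[R]_(a, b)) :
  smooth_on U c -> smooth_on U f -> smooth_on U (fun x => c x *: f x).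
Proof.
move=> sc sf; apply: smooth_mx => i j.
apply: smooth_ext (smooth_mul sc (smooth_entry i j sf)) => x _.
by rewrite mxE.
Qed.

Lemma smooth_mulmx a b c (f : V -> 'M[R]_(a, b)) (g : V -> 'M[R]_(b, c)) :
  smooth_on U f -> smooth_on U g -> smooth_on U (fun x => f x *m g x).
Proof.
move=> sf sg; apply: smooth_mx => i j.
apply: (smooth_ext (f := fun x => \sum_k f x i k * g x k j)).
  by move=> x _; rewrite mxE.
by apply: smooth_sum => k; apply: smooth_mul; apply: smooth_entry.
Qed.

Lemma smooth_det a (f : V -> 'M[R]_a) :
  smooth_on U f -> smooth_on U (fun x => \det (f x)).
Proof.
move=> sf; apply: smooth_sum => s; apply: smooth_mul; first exact: smooth_cst.
by apply: smooth_prod => i; apply: smooth_entry.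
Qed.

Lemma smooth_adj a (f : V -> 'M[R]_a) :
  smooth_on U f -> smooth_on U (fun x => \adj (f x)).
Proof.
move=> sf; apply: smooth_mx => i j.
apply: (smooth_ext (f := fun x => cofactor (f x) j i)).
  by move=> x _; rewrite mxE.
apply: smooth_mul; first exact: smooth_cst.
apply: smooth_det; apply: smooth_mx => k l.
apply: smooth_ext (smooth_entry (lift j k) (lift i l) sf) => x _.
by rewrite !mxE.
Qed.

(** By Cramer's rule the inverse is a rational function of the entries. *)
Lemma smooth_invmx a (f : V -> 'M[R]_a) : (forall x, U x -> f x \in unitmx) ->
  smooth_on U f -> smooth_on U (fun x => invmx (f x)).
Proof.
move=> uf sf.
apply: (smooth_ext (f := fun x => (\det (f x))^-1 *: \adj (f x))).
  by move=> x Ux; rewrite /invmx uf.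
apply: smooth_scale; last exact: smooth_adj.
by apply: smooth_inv => [x /uf|]; [rewrite unitmxE unitfE|exact: smooth_det].
Qed.

Lemma smooth_row_mx a b c (f : V -> 'M[R]_(a, b)) (g : V -> 'M[R]_(a, c)) :
  smooth_on U f -> smooth_on U g -> smooth_on U (fun x => row_mx (f x) (g x)).
Proof.
move=> sf sg; apply: smooth_mx => i j.
have [k|k] := fintype.splitP j => jk.
  apply: smooth_ext (smooth_entry i k sf) => x _.
  by rewrite (_ : j = lshift c k) ?row_mxEl //; apply: val_inj.
apply: smooth_ext (smooth_entry i k sg) => x _.
by rewrite (_ : j = rshift b k) ?row_mxEr //; apply: val_inj.
Qed.

(** A pair (f, g) is the sum of (f, 0) and (0, g), each of them the composition
   with a linear map. *)
Lemma smooth_pair (W W' : normedModType R) (f : V -> W) (g : V -> W') :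
  smooth_on U f -> smooth_on U g -> smooth_on U (fun x => (f x, g x)).
Proof.
move=> sf sg.
have lin1 : linear (fun x : W => (x, 0 : W')).
  by move=> c x y; congr (_, _); rewrite /= scaler0 addr0.
have lin2 : linear (fun x : W' => (0 : W, x)).
  by move=> c x y; congr (_, _); rewrite /= scaler0 addr0.
pose l1M := GRing.isLinear.Build _ _ _ _ _ lin1.
pose l1 : {linear _ -> _} := HB.pack (fun x : W => (x, 0 : W')) l1M.
pose l2M := GRing.isLinear.Build _ _ _ _ _ lin2.
pose l2 : {linear _ -> _} := HB.pack (fun x : W' => (0 : W, x)) l2M.
apply: (smooth_ext (f := fun x => l1 (f x) + l2 (g x))).
  by move=> x _; congr (_, _); rewrite /= ?addr0 ?add0r.
by apply: smooth_add; apply: smooth_lin => //= x; apply: cvg_pair => /=;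
  first [exact: cvg_id | exact: cvg_cst].
Qed.

End SmoothOn.

(** * Submanifolds from charts with a global parametrization *)

Section Charts.
Variable R : realType.

Lemma smooth_comp_lin (V V' W : normedModType R) (U : set V) (f : V -> W)
  (l : {linear V' -> V}) : open U -> continuous l -> smooth_on U f ->
  smooth_on (l @^-1` U) (fun x => f (l x)).
Proof. by move=> oU cl sf k; apply: Ck_pre. Qed.

Lemma smooth_subset (V W : normedModType R) (U U' : set V) (f : V -> W) :
  U' `<=` U -> smooth_on U f -> smooth_on U' f.
Proof. by move=> sU sf k; apply: Ck_subset (sf k). Qed.

Lemma smooth_continuous (V W : normedModType R) (f : V -> W) :
  smooth_on setT f -> continuous f.
Proof. by move=> sf x; apply: (sf 0). Qed.

Lemma open_neq0 (V : normedModType R) (h : V -> R) :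
  smooth_on setT h -> open [set q | h q != 0].
Proof.
move=> /smooth_continuous ch.
apply: (@open_comp _ _ h [set x | x != 0]) => [x _|]; first exact: ch.
exact: open_neq.
Qed.

(** It suffices to give a parametrization phi of part of S by the whole of R^d
   and a map psi, smooth where a smooth function h does not vanish, that inverts
   phi there. The domain of the chart is then the open set of the w such that
   h (phi w) is not zero: there is no need to describe it explicitly. *)
Lemma chart_submanifold (V : normedModType R) d (S : set V) :
  (forall p, S p -> exists (h : V -> R) (phi : 'rV[R]_d -> V) (psi : V -> 'rV[R]_d),
    [/\ smooth_on setT h, h p != 0, smooth_on setT phi &
        smooth_on [set q | h q != 0] psi] /\
    [/\ forall w, S (phi w),
        forall q, S q -> h q != 0 -> phi (psi q) = q &
        forall w, h (phi w) != 0 -> psi (phi w) = w]) ->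
  submanifold d S.
Proof.
move=> H p /H[h [phi [psi [[sh hp sphi spsi] [Sphi phiK psiK]]]]].
have oU := open_neq0 sh.
exists (phi @^-1` [set q | h q != 0]), [set q | h q != 0], phi, psi.
split; split => //.
- by apply: open_comp oU => x _; apply: (smooth_continuous sphi).
- by apply: smooth_subset sphi.
- apply/seteqP; split=> [_ [w hw <-]|q [Sq hq]]; first by split.
  by exists (psi q); rewrite /= phiK.
Qed.

Section Product.
Variables V1 V2 : normedModType R.

Let fst_lin : linear (fst : V1 * V2 -> V1). Proof. by []. Qed.
Let snd_lin : linear (snd : V1 * V2 -> V2). Proof. by []. Qed.
HB.instance Definition _ := GRing.isLinear.Build _ _ _ _ _ fst_lin.
HB.instance Definition _ := GRing.isLinear.Build _ _ _ _ _ snd_lin.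

Let fstL : {linear (V1 * V2)%type -> V1} := fst.
Let sndL : {linear (V1 * V2)%type -> V2} := snd.

Let fstC : continuous fstL. Proof. by move=> x; apply: cvg_fst. Qed.
Let sndC : continuous sndL. Proof. by move=> x; apply: cvg_snd. Qed.

Lemma smooth_fst (V : normedModType R) (U : set V) (f : V -> V1 * V2) :
  open U -> smooth_on U f -> smooth_on U (fun x => (f x).1).
Proof. by move=> oU; apply: (smooth_lin oU (l := fstL)). Qed.

Lemma smooth_snd (V : normedModType R) (U : set V) (f : V -> V1 * V2) :
  open U -> smooth_on U f -> smooth_on U (fun x => (f x).2).
Proof. by move=> oU; apply: (smooth_lin oU (l := sndL)). Qed.

Lemma submanifold_prod d1 d2 (S1 : set V1) (S2 : set V2) :
  submanifold d1 S1 -> submanifold d2 S2 ->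
  submanifold (d1 + d2) (S1 `*` S2).
Proof.
move=> H1 H2 [p1 p2] [/= /H1 + /H2].
move=> [W1 [U1 [phi1 [psi1 [[oW1 oU1 U1p] [sphi1 spsi1 im1 K1]]]]]].
move=> [W2 [U2 [phi2 [psi2 [[oW2 oU2 U2p] [sphi2 spsi2 im2 K2]]]]]].
pose lL : {linear 'rV[R]_(d1 + d2) -> 'rV_d1} := lsubmx.
pose rL : {linear 'rV[R]_(d1 + d2) -> 'rV_d2} := rsubmx.
have cl : continuous lL by exact: continuous_linear_mx.
have cr : continuous rL by exact: continuous_linear_mx.
have oW1' : open (lL @^-1` W1) by apply: open_comp => // x _; apply: cl.
have oW2' : open (rL @^-1` W2) by apply: open_comp => // x _; apply: cr.
have oU1' : open (fstL @^-1` U1) by apply: open_comp => // x _; apply: fstC.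
have oU2' : open (sndL @^-1` U2) by apply: open_comp => // x _; apply: sndC.
have oW := openI oW1' oW2'; have oU := openI oU1' oU2'.
exists (lL @^-1` W1 `&` rL @^-1` W2), (fstL @^-1` U1 `&` sndL @^-1` U2).
exists (fun w => (phi1 (lL w), phi2 (rL w))).
exists (fun q => row_mx (psi1 (fstL q)) (psi2 (sndL q))).
split; split => //.
- apply: smooth_pair => //.
    by apply: smooth_subset (smooth_comp_lin oW1 cl sphi1) => x [].
  by apply: smooth_subset (smooth_comp_lin oW2 cr sphi2) => x [].
- apply: smooth_row_mx => //.
    by apply: smooth_subset (smooth_comp_lin oU1 fstC spsi1) => x [].
  by apply: smooth_subset (smooth_comp_lin oU2 sndC spsi2) => x [].
- apply/seteqP; split=> [_ [w [Ww1 Ww2] <-]|[q1 q2] [[/= Sq1 Sq2] [Uq1 Uq2]]].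
    have [Sa Ua] : (S1 `&` U1) (phi1 (lL w)) by rewrite -im1; exists (lL w).
    have [Sb Ub] : (S2 `&` U2) (phi2 (rL w)) by rewrite -im2; exists (rL w).
    by split; split.
  have [w1 Ww1 <-] : (phi1 @` W1) q1 by rewrite im1; split.
  have [w2 Ww2 <-] : (phi2 @` W2) q2 by rewrite im2; split.
  exists (row_mx w1 w2); last by rewrite /lL /rL /= row_mxKl row_mxKr.
  by split; rewrite /= ?row_mxKl ?row_mxKr.
- by move=> w [Ww1 Ww2] /=; rewrite /fstL /sndL /= K1 // K2 // hsubmxK.
Qed.

End Product.

Lemma is_derive_mulmx a b c (f : R -> 'M[R]_(a, b)) (g : R -> 'M[R]_(b, c)) t df dg :
  is_derive t (1 : R) f df -> is_derive t (1 : R) g dg ->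
  is_derive t (1 : R) (fun s => f s *m g s) (df *m g t + f t *m dg).
Proof.
move=> [Df Ef] [Dg Eg].
have entryD i j (h : R -> 'M[R]_(i, j)) k l : derivable h t 1 ->
  derivable (fun s => h s k l) t 1 by move=> /derivable_mxP; apply.
have Dfg : derivable (fun s => f s *m g s) t 1.
  apply/derivable_mxP => i j.
  rewrite (_ : (fun _ => _) = \sum_k (fun s => f s i k) * (fun s => g s k j)).
    by apply: derivable_sum => k; apply: derivableM; apply: entryD.
  by rewrite funeqE => s; rewrite mxE fct_sumE.
split=> //; rewrite derive_mx //; apply/matrixP => i j; rewrite !mxE.
rewrite (_ : (fun _ => _) = \sum_k (fun s => f s i k) * (fun s => g s k j)); last first.
  by rewrite funeqE => s; rewrite mxE fct_sumE.
rewrite derive_sum; last by move=> k; apply: derivableM; apply: entryD.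
rewrite -big_split /=; apply: eq_bigr => k _.
rewrite deriveM; [|exact: entryD|exact: entryD].
rewrite -Ef -Eg !derive_mx // !mxE addrC; congr (_ + _).
by rewrite mulrC.
Qed.

Lemma is_derive_trmx a b (f : R -> 'M[R]_(a, b)) t df :
  is_derive t (1 : R) f df -> is_derive t (1 : R) (fun s => (f s)^T) df^T.
Proof.
move=> [Df Ef].
have Dt : derivable (fun s => (f s)^T) t 1.
  apply/derivable_mxP => i j.
  rewrite (_ : (fun _ => _) = fun s => f s j i).
    by move/derivable_mxP : Df; apply.
  by rewrite funeqE => s; rewrite mxE.
split=> //; rewrite -Ef !derive_mx //; apply/matrixP => i j; rewrite !mxE.
by congr ('D_1 _ t); rewrite funeqE => s; rewrite mxE.
Qed.

Lemma is_derive_unique (W : normedModType R) (f : R -> W) t u v :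
  is_derive t (1 : R) f u -> is_derive t (1 : R) f v -> u = v.
Proof. by case=> _ <- [_ <-]. Qed.

Lemma is_derive_pair (V1 V2 : normedModType R) (f : R -> V1 * V2) t u :
  is_derive t (1 : R) f u ->
  is_derive t (1 : R) (fun s => (f s).1) u.1 /\
  is_derive t (1 : R) (fun s => (f s).2) u.2.
Proof.
move=> [/cvg_ex[l fl] <-].
have l1 : (h^-1 *: ((f (h *: 1 + t)).1 - (f t).1) @[h --> 0^'] --> l.1).
  exact: (cvg_comp _ _ fl cvg_fst).
have l2 : (h^-1 *: ((f (h *: 1 + t)).2 - (f t).2) @[h --> 0^'] --> l.2).
  exact: (cvg_comp _ _ fl cvg_snd).
rewrite /derive (cvg_lim _ fl) //.
split; split; try (by apply/cvg_ex; eexists; eassumption);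
  by apply: cvg_lim.
Qed.

End Charts.

(** * Orthonormal frames of real vectors *)

Section Dot.
Variables (R : realType) (m : nat).
Implicit Types (u v w : 'cV[R]_m) (A : 'M[R]_m).

Definition dot u v : R := (u^T *m v) 0 0.

Lemma dotE u v : u^T *m v = (dot u v)%:M.
Proof. by rewrite [LHS]mx11_scalar. Qed.

Lemma dot_sum u v : dot u v = \sum_i u i 0 * v i 0.
Proof. by rewrite /dot mxE; apply: eq_bigr => i _; rewrite mxE. Qed.

Lemma dotC u v : dot u v = dot v u.
Proof. by rewrite !dot_sum; apply: eq_bigr => i _; rewrite mulrC. Qed.

Lemma dotDl u1 u2 v : dot (u1 + u2) v = dot u1 v + dot u2 v.
Proof. by rewrite /dot linearD mulmxDl mxE. Qed.
Lemma dotDr u v1 v2 : dot u (v1 + v2) = dot u v1 + dot u v2.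
Proof. by rewrite /dot mulmxDr mxE. Qed.
Lemma dotNl u v : dot (- u) v = - dot u v.
Proof. by rewrite /dot linearN mulNmx mxE. Qed.
Lemma dotNr u v : dot u (- v) = - dot u v.
Proof. by rewrite /dot mulmxN mxE. Qed.
Lemma dotZl a u v : dot (a *: u) v = a * dot u v.
Proof. by rewrite /dot linearZ /= -scalemxAl mxE. Qed.
Lemma dotZr a u v : dot u (a *: v) = a * dot u v.
Proof. by rewrite /dot -scalemxAr mxE. Qed.
Lemma dot0l v : dot 0 v = 0.
Proof. by rewrite /dot trmx0 mul0mx mxE. Qed.
Lemma dot0r v : dot v 0 = 0.
Proof. by rewrite /dot mulmx0 mxE. Qed.

Definition dotL := (dotDl, dotDr, dotNl, dotNr, dotZl, dotZr, dot0l, dot0r).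

Lemma dot_mull A u v : dot (A *m u) v = dot u (A^T *m v).
Proof. by rewrite /dot trmx_mul mulmxA. Qed.

Lemma rank1_mul u v w : u *m v^T *m w = dot v w *: u.
Proof. by rewrite -mulmxA dotE mul_mx_scalar. Qed.

Lemma dot_ge0 v : 0 <= dot v v.
Proof. by rewrite dot_sum; apply: sumr_ge0 => i _; rewrite -expr2 sqr_ge0. Qed.

Lemma dot_eq0 v : (dot v v == 0) = (v == 0).
Proof.
apply/eqP/eqP => [|->]; last by rewrite dot0l.
rewrite dot_sum => /eqP; rewrite psumr_eq0 => [/allP H|i _]; last first.
  by rewrite -expr2 sqr_ge0.
apply/matrixP => i j; rewrite ord1 mxE.
by have := H i (mem_index_enum _); rewrite /= mulf_eq0 orbb => /eqP.
Qed.

Lemma dot_gt0 v : v != 0 -> 0 < dot v v.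
Proof. by move=> v0; rewrite lt_def dot_eq0 v0 dot_ge0. Qed.

Lemma exists_unit v : v != 0 -> exists2 c, 0 < c & dot (c *: v) (c *: v) = 1.
Proof.
move=> /dot_gt0 v0; exists (Num.sqrt (dot v v))^-1.
  by rewrite invr_gt0 sqrtr_gt0.
rewrite !dotL mulrA -invfM -expr2 sqr_sqrtr ?dot_ge0 // mulVf //.
by rewrite gt_eqF.
Qed.

Definition orth A := A *m A^T = 1%:M.

Lemma orthT A : orth A -> A^T *m A = 1%:M.
Proof. exact: mulmx1C. Qed.

Lemma orth_tr A : orth A -> orth A^T.
Proof. by rewrite /orth trmxK => /orthT. Qed.

Lemma orth_mul A B : orth A -> orth B -> orth (A *m B).
Proof.
by move=> oA oB; rewrite /orth trmx_mul mulmxA -[A *m B *m _]mulmxA oB mulmx1.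
Qed.

Lemma orth1 : orth 1%:M. Proof. by rewrite /orth trmx1 mul1mx. Qed.

Lemma orth_det A : orth A -> \det A = 1 \/ \det A = -1.
Proof.
move=> /(congr1 determinant); rewrite det_mulmx det_tr det1 -expr2 => /eqP.
by rewrite sqrf_eq1 => /orP[] /eqP; [left|right].
Qed.

Lemma orth_inv A : orth A -> invmx A = A^T.
Proof.
move=> oA; have [uA _] := mulmx1_unit oA.
by rewrite -[RHS](mulKmx uA) oA mulmx1.
Qed.

Lemma orth_dot A u v : orth A -> dot (A *m u) (A *m v) = dot u v.
Proof. by move=> oA; rewrite dot_mull mulmxA orthT // mul1mx. Qed.

(** Both sides are the determinant of the block matrix with diagonal blocks 1
   and off-diagonal blocks v^T and u, reduced by elimination of either of its
   off-diagonal blocks. *)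
Lemma det_1_rank1 u v : \det (1%:M - u *m v^T) = 1 - dot v u.
Proof.
pose X := block_mx 1%:M v^T u 1%:M.
have -> : \det (1%:M - u *m v^T) = \det X.
  have -> : \det X = \det (block_mx 1%:M 0 (- u) 1%:M *m X).
    by rewrite det_mulmx det_lblock !det1 !mul1r.
  rewrite mulmx_block !mul1mx !mul0mx !mulNmx !mulmx1 !addr0 [- u + _]addrC subrr.
  by rewrite det_ublock det1 mul1r addrC.
have -> : \det X = \det (block_mx 1%:M (- v^T) 0 1%:M *m X).
  by rewrite det_mulmx det_ublock !det1 !mul1r.
rewrite mulmx_block !mul1mx !mul0mx !mulNmx !mulmx1 !add0r [v^T + _]addrC.
rewrite [- v^T + _]addrC subrr det_lblock det1 mulr1 dotE.
by rewrite det_mx11 !mxE.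
Qed.

Definition reflection w := 1%:M - (2 / dot w w) *: (w *m w^T).

Lemma reflectionE w v : reflection w *m v = v - (2 * dot w v / dot w w) *: w.
Proof.
rewrite /reflection mulmxBl mul1mx -scalemxAl rank1_mul scalerA.
by rewrite mulrAC.
Qed.

Lemma reflection_tr w : (reflection w)^T = reflection w.
Proof.
by rewrite /reflection linearB /= trmx1 linearZ /= trmx_mul trmxK.
Qed.

Lemma eq_mulcv A B : (forall v, A *m v = B *m v) -> A = B.
Proof.
move=> AB; apply/matrixP => i j.
by have := AB (delta_mx j 0); rewrite -!colE => /colP/(_ i); rewrite !mxE.
Qed.

Lemma reflection_orth w : orth (reflection w).
Proof.
have [->|w0] := eqVneq w 0.
  by rewrite /reflection mul0mx scaler0 subr0 /orth trmx1 mul1mx.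
have d0 : dot w w != 0 by rewrite dot_eq0.
rewrite /orth reflection_tr; apply: eq_mulcv => v.
rewrite -mulmxA !reflectionE !dotL mul1mx -addrA -opprD -scalerDl.
rewrite [X in X *: _](_ : _ = 0) ?scale0r ?subr0 //.
by field.
Qed.

Lemma reflection_det w : w != 0 -> \det (reflection w) = -1.
Proof.
rewrite -dot_eq0 => d0.
rewrite /reflection scalemxAl det_1_rank1 !dotL; field.
by [].
Qed.

Lemma reflection_swap a b : dot a a = dot b b -> reflection (a - b) *m a = b.
Proof.
move=> ab; have [->|] := eqVneq a b.
  by rewrite subrr reflectionE scaler0 subr0.
rewrite -subr_eq0 -dot_eq0 => d0.
rewrite reflectionE.
have -> : 2 * dot (a - b) a = dot (a - b) (a - b).
  by rewrite !dotL (dotC b a) -ab; ring.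
by rewrite mulfV // scale1r opprB addrC subrK.
Qed.

End Dot.

Section Frames.
Variable (R : realType).

Lemma frame_cons m k (a : 'cV[R]_m) (A : 'M[R]_(m, k)) :
  (row_mx a A)^T *m row_mx a A = 1%:M <->
  [/\ dot a a = 1, A^T *m a = 0 & A^T *m A = 1%:M].
Proof.
rewrite tr_row_mx mul_col_row scalar_mx_block dotE; split.
  move=> /eq_block_mx[aa _ Aa AA]; split=> //.
  by have := congr1 (fun M : 'M[R]_1 => M 0 0) aa; rewrite !mxE.
case=> -> Aa ->; rewrite Aa.
by rewrite (_ : a^T *m A = 0) // -[RHS]trmx0 -Aa trmx_mul trmxK.
Qed.

(** A frame is a matrix with orthonormal columns. By induction on the number of
   columns: once all the columns but one have been moved to their targets, the
   reflection that moves the remaining one fixes the others, as it is along a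
   vector orthogonal to them. *)
Lemma frame_transitive m k (A B : 'M[R]_(m, k)) :
  A^T *m A = 1%:M -> B^T *m B = 1%:M -> exists2 g, orth g & g *m A = B.
Proof.
elim: k A B => [A B|k IH].
  by move=> _ _; exists 1%:M; [exact: orth1|apply/matrixP => i []].
rewrite -[k.+1]/(1 + k)%N => A B; rewrite -[A]hsubmxK -[B]hsubmxK.
set a := lsubmx _; set A' := rsubmx _; set b := lsubmx _; set B' := rsubmx _.
move=> /frame_cons[aa Aa AA] /frame_cons[bb Bb BB].
have [g og gA] := IH A' B' AA BB.
(* The case ga = b is included, as the reflection along 0 is the identity. *)
exists (reflection (g *m a - b) *m g).
  by apply: orth_mul => //; exact: reflection_orth.
rewrite mul_mx_row -!mulmxA gA reflection_swap ?orth_dot ?aa //.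
have E : (g *m a - b)^T *m B' = 0.
  have trM (u : 'cV[R]_m) (M : 'M[R]_(m, k)) : M^T *m u = 0 -> u^T *m M = 0.
    by move=> H; rewrite -[LHS]trmxK trmx_mul trmxK H trmx0.
  rewrite linearB /= mulmxBl [b^T *m _]trM // subr0 -gA trmx_mul mulmxA.
  by rewrite -[_ *m g^T *m g]mulmxA orthT // mulmx1 trM.
congr row_mx.
by rewrite /reflection mulmxBl mul1mx -scalemxAl -mulmxA E mulmx0 scaler0 subr0.
Qed.

Lemma orthogonal_unit m k (B : 'M[R]_(m, k)) : (k < m)%N ->
  exists2 w, dot w w = 1 & B^T *m w = 0.
Proof.
move=> km; have K0 : kermx B != 0.
  rewrite kermx_eq0 -row_leq_rank -ltnNge; exact: leq_ltn_trans (rank_leq_col B) km.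
have kB : nz_row (kermx B) *m B = 0 by apply/sub_kermxP/nz_row_sub.
have v0 : (nz_row (kermx B))^T != 0.
  by rewrite -trmx0 (inj_eq trmx_inj) nz_row_eq0.
have [c _ cv] := exists_unit v0; exists (c *: (nz_row (kermx B))^T) => //.
by rewrite -scalemxAr -trmx_mul kB trmx0 scaler0.
Qed.

(** If the frame is not a basis, the determinant can be corrected by a
   reflection along a vector orthogonal to the target frame. *)
Lemma frame_SO_transitive m k (A B : 'M[R]_(m, k)) : (k < m)%N ->
  A^T *m A = 1%:M -> B^T *m B = 1%:M -> exists2 g, SO g & g *m A = B.
Proof.
move=> km AA BB; have [g og gA] := frame_transitive AA BB.
have [dg|dg] := orth_det og; first by exists g.
have [w ww Bw] := orthogonal_unit B km.
have w0 : w != 0 by rewrite -dot_eq0 ww oner_neq0.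
exists (reflection w *m g).
  split; first by apply: orth_mul => //; exact: reflection_orth.
  by rewrite det_mulmx reflection_det // dg mulrNN mulr1.
rewrite -mulmxA gA /reflection mulmxBl mul1mx -scalemxAl -mulmxA.
by rewrite -[w^T *m _]trmxK trmx_mul trmxK Bw trmx0 mulmx0 scaler0 subr0.
Qed.

Lemma frame_complement k l (A : 'M[R]_(k + l, k)) : A^T *m A = 1%:M ->
  exists N : 'M[R]_(k + l, l),
    [/\ N^T *m N = 1%:M, N^T *m A = 0 & A *m A^T + N *m N^T = 1%:M].
Proof.
move=> AA.
pose E : 'M[R]_(k + l, k) := col_mx 1%:M 0.
pose F : 'M[R]_(k + l, l) := col_mx 0 1%:M.
have EE : E^T *m E = 1%:M.
  by rewrite tr_col_mx mul_row_col trmx1 trmx0 mul1mx mul0mx addr0.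
have [g og gE] := frame_transitive EE AA.
exists (g *m F); rewrite -gE !trmx_mul !mulmxA.
rewrite -![_ *m g^T *m g]mulmxA orthT // !mulmx1 /E /F.
rewrite !tr_col_mx !mul_row_col !trmx1 !trmx0 !mul0mx !mul1mx add0r addr0.
split=> //.
rewrite -mulmxDl -![g *m _ *m _]mulmxA -mulmxDr.
rewrite !mul_col_row !mul0mx !mulmx0 !mul1mx add_block_mx !addr0 !add0r.
by rewrite -scalar_mx_block mulmx1.
Qed.

End Frames.

(** * Orthogonal complex structures *)

Section ComplexStructures.
Variable R : realType.

Definition cstruct m (J : 'M[R]_m) := J^T = - J /\ J *m J = - 1%:M.

(** The columns of F are a unitary basis of a complex subspace, for the complex
   structure J. *)
Definition adapted m k (J : 'M[R]_m) (F : 'M[R]_(m, k)) :=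
  F^T *m F = 1%:M /\ F^T *m J *m F = 0.

Lemma skew_dot m (J : 'M[R]_m) v : J^T = - J -> dot v (J *m v) = 0.
Proof.
move=> Jt; have : dot v (J *m v) = - dot v (J *m v).
  by rewrite {1}dotC dot_mull Jt mulNmx dotNr.
by move/eqP; rewrite -addr_eq0 -mulr2n mulrn_eq0 /= => /eqP.
Qed.

Lemma cstruct_dot m (J : 'M[R]_m) u v : cstruct J ->
  dot (J *m u) (J *m v) = dot u v.
Proof.
by case=> Jt JJ; rewrite dot_mull Jt mulmxA mulNmx JJ opprK mul1mx.
Qed.

Lemma dotE11 m (u v : 'cV[R]_m) : u^T *m v = 0 <-> dot u v = 0.
Proof.
split=> [E|E]; first by rewrite /dot E mxE.
by rewrite dotE E; apply/matrixP => i j; rewrite !mxE mul0rn.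
Qed.

Lemma adapted_extend m k (J : 'M[R]_m) (F : 'M[R]_(m, k)) :
  cstruct J -> (k + k < m)%N -> adapted J F ->
  exists w : 'cV[R]_m, adapted J (row_mx w F).
Proof.
move=> [Jt JJ] km [FF FJF].
have [w ww /eqP] := orthogonal_unit (row_mx F (J *m F)) km.
rewrite tr_row_mx mul_col_mx col_mx_eq0 => /andP[/eqP Fw /eqP JFw].
exists w; split; first exact/frame_cons.
have FJw : F^T *m J *m w = 0.
  by move: JFw; rewrite trmx_mul Jt mulmxN mulNmx => /eqP; rewrite oppr_eq0 => /eqP.
rewrite tr_row_mx mul_col_mx mul_col_row FJw FJF.
have -> : w^T *m J *m w = 0 by rewrite -mulmxA; apply/dotE11; exact: skew_dot.
have -> : w^T *m J *m F = 0.
  have := congr1 trmx FJw; rewrite !trmx_mul trmxK trmx0 Jt mulNmx mulmxN.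
  by rewrite mulmxA => /eqP; rewrite oppr_eq0 => /eqP.
by rewrite block_mx0.
Qed.

Lemma adapted1 m (J : 'M[R]_m) (w : 'cV[R]_m) :
  cstruct J -> dot w w = 1 -> adapted J w.
Proof.
move=> [Jt JJ] ww; split; first by rewrite dotE ww.
by rewrite -mulmxA; apply/dotE11; exact: skew_dot.
Qed.

(** Unitary bases for J and J' can be built in parallel so that the given unit
   vectors w and w' have the same coordinates e. *)
Lemma adapted_pair m n (J J' : 'M[R]_m) (w w' : 'cV[R]_m) :
  m = (n.+1 + n.+1)%N -> cstruct J -> cstruct J' ->
  dot w w = 1 -> dot w' w' = 1 ->
  exists F F' : 'M[R]_(m, n.+1), exists e : 'cV[R]_n.+1,
    [/\ adapted J F, adapted J' F', F *m e = w & F' *m e = w'].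
Proof.
move=> mE cJ cJ' ww ww'.
suff H k : (k <= n)%N -> exists F F' : 'M[R]_(m, k.+1), exists e : 'cV[R]_k.+1,
    [/\ adapted J F, adapted J' F', F *m e = w & F' *m e = w'] by exact: H.
elim: k => [_|k IH kn].
  exists w, w', 1%:M; split; [exact: adapted1|exact: adapted1| |];
  exact: mulmx1.
have [F [F' [e [aF aF' Fe Fe']]]] := IH (ltnW kn).
have km : (k.+1 + k.+1 < m)%N by rewrite mE; lia.
have [u au] := adapted_extend cJ km aF.
have [u' au'] := adapted_extend cJ' km aF'.
exists (row_mx u F), (row_mx u' F'), (col_mx (0 : 'cV[R]_1) e); split=> //.
  by rewrite (@mul_row_col _ _ 1 k.+1) mulmx0 add0r.
by rewrite (@mul_row_col _ _ 1 k.+1) mulmx0 add0r.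
Qed.

Lemma adapted_unitary m n (J : 'M[R]_m) (F : 'M[R]_(m, n)) : cstruct J ->
  adapted J F ->
  [/\ (J *m F)^T *m F = 0, F^T *m (J *m F) = 0 & (J *m F)^T *m (J *m F) = 1%:M].
Proof.
move=> [Jt JJ] [FF FJF]; rewrite trmx_mul Jt mulmxN mulNmx FJF oppr0 mulmxA.
split=> //; rewrite mulNmx !mulmxA -[F^T *m J *m J]mulmxA JJ mulmxN mulmx1.
by rewrite mulNmx opprK.
Qed.

Lemma adapted_frame m n (J : 'M[R]_m) (F : 'M[R]_(m, n)) : cstruct J ->
  adapted J F -> (row_mx F (J *m F))^T *m row_mx F (J *m F) = 1%:M.
Proof.
move=> cJ aF; have [GF FG GG] := adapted_unitary cJ aF.
rewrite tr_row_mx mul_col_row GF FG GG scalar_mx_block.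
by case: aF => ->.
Qed.

Lemma adapted_complete m n (J : 'M[R]_m) (F : 'M[R]_(m, n)) :
  m = (n + n)%N -> cstruct J -> adapted J F ->
  F *m F^T + (J *m F) *m (J *m F)^T = 1%:M.
Proof.
move=> mE; subst m => cJ aF.
by rewrite -(mulmx1C (adapted_frame cJ aF)) tr_row_mx mul_row_col.
Qed.

(** The determinant of the real matrix of the complex endomorphism A + iC is the
   squared modulus of the determinant of A + iC. *)
Lemma block_complex_det_ge0 n (A C : 'M[R]_n) :
  0 <= \det (block_mx A (- C) C A).
Proof.
pose f := real_complex R; pose z := 'i%C : R[i].
have zz : z * z = -1 by rewrite -expr2 sqr_i.
pose X := map_mx f (block_mx A (- C) C A).
pose L := block_mx 1%:M z%:M 0 1%:M : 'M_(n + n).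
pose D := block_mx 1%:M (- z)%:M 0 1%:M : 'M_(n + n).
have dL : \det L = 1 by rewrite det_ublock !det1 mulr1.
have dD : \det D = 1 by rewrite det_ublock !det1 mulr1.
pose P := map_mx f A + z *: map_mx f C.
pose Q := map_mx f A - z *: map_mx f C.
have E : L *m X *m D = block_mx P 0 (map_mx f C) Q.
  rewrite /X map_block_mx map_mxN /L mulmx_block !mul1mx !mul0mx !add0r.
  rewrite !mul_scalar_mx /D mulmx_block !mulmx1 !mulmx0 !addr0.
  rewrite !mul_mx_scalar; congr block_mx.
    apply/matrixP => i j; rewrite !mxE; set a := f (A i j); set c := f (C i j).
    transitivity (- (z * z + 1) * c); first by ring.
    by rewrite zz addNr oppr0 mul0r.
  by rewrite scaleNr addrC.
have QP : Q = map_mx conjc P.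
  apply/matrixP => i j; rewrite !mxE.
  by rewrite /f /z; simpc.
have : \det X = \det P * conjc (\det P).
  rewrite -[LHS]mul1r -dL -det_mulmx -[LHS]mulr1 -dD -det_mulmx E det_lblock.
  by rewrite QP det_map_mx.
rewrite det_map_mx => dX.
rewrite -ler0c; apply: le_trans (mulcJ_ge0 (\det P)) _.
by rewrite -dX.
Qed.

Lemma comm_det_ge0 m n (J X : 'M[R]_m) : m = (n.+1 + n.+1)%N -> cstruct J ->
  X *m J = J *m X -> 0 <= \det X.
Proof.
move=> mE cJ XJ.
have [w ww _] := @orthogonal_unit R m 0 0 ltac:(by rewrite mE).
have [F [_ [_ [aF _ _ _]]]] := adapted_pair mE cJ cJ ww ww.
move: w ww X XJ cJ F aF; subst m => _ _ X XJ cJ F aF.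
have [Jt JJ] := cJ.
set h := row_mx F (J *m F); have hh : h^T *m h = 1%:M := adapted_frame cJ aF.
have hh' := mulmx1C hh.
have -> : \det X = \det (h^T *m X *m h).
  by rewrite !det_mulmx mulrAC -det_mulmx hh det1 mul1r.
have E : h^T *m X *m h = block_mx (F^T *m X *m F) (- ((J *m F)^T *m X *m F))
   ((J *m F)^T *m X *m F) (F^T *m X *m F).
  rewrite /h tr_row_mx mul_col_mx mul_col_row; congr block_mx.
    rewrite trmx_mul Jt mulmxN !mulNmx opprK !mulmxA.
    by rewrite -[F^T *m X *m J]mulmxA XJ mulmxA.
  rewrite trmx_mul Jt mulmxN !mulNmx !mulmxA.
  rewrite -[_ *m X *m J]mulmxA XJ mulmxA -[F^T *m J *m J]mulmxA JJ mulmxN mulmx1.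
  by rewrite !mulNmx opprK.
by rewrite E block_complex_det_ge0.
Qed.

Lemma unit_inj m (A : 'M[R]_m) : (forall v : 'cV[R]_m, A *m v = 0 -> v = 0) ->
  A \in unitmx.
Proof.
move=> H; rewrite -unitmx_tr -row_free_unit -kermx_eq0; apply/eqP.
apply/row_matrixP => i; rewrite row0; apply: trmx_inj; rewrite trmx0.
by apply: H; rewrite -{1}[A]trmxK -trmx_mul -row_mul mulmx_ker row0 trmx0.
Qed.

Lemma skew_unit m (Z : 'M[R]_m) : Z^T = - Z -> 1%:M - Z \in unitmx.
Proof.
move=> Zt; apply: unit_inj => v; rewrite mulmxBl mul1mx => /eqP.
rewrite subr_eq0 => /eqP E; apply/eqP; rewrite -dot_eq0.
by rewrite {2}E skew_dot.
Qed.

(** The determinant of 1 - tZ does not vanish for any real t, and it is 1 at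
   t = 0. *)
Lemma skew_det_gt0 m (Z : 'M[R]_m) : Z^T = - Z -> 0 < \det (1%:M - Z).
Proof.
move=> Zt; pose f (t : R) := \det (1%:M - t *: Z).
have f0 t : f t != 0.
  rewrite -unitfE -unitmxE skew_unit //.
  by rewrite linearZ /= Zt scalerN.
have cf : continuous f.
  apply: smooth_continuous; apply: smooth_det; first exact: openT.
  apply: smooth_add; [exact: openT|exact: smooth_cst|].
  apply: smooth_opp; first exact: openT.
  by apply: smooth_scale; [exact: openT|exact: (smooth_id openT)|exact: smooth_cst].
have f0E : f 0 = 1 by rewrite /f scale0r subr0 det1.
have f1E : f 1 = \det (1%:M - Z) by rewrite /f scale1r.
rewrite -f1E ltNge; apply/negP => f1.
have [||c _ /eqP] := @IVT R f 0 1 0 ler01.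
- by apply: continuous_subspaceT.
- by rewrite f0E ge_min f1 orbT /= le_max ler01.
by rewrite (negbTE (f0 c)).
Qed.

(** Unitary bases for J and J' yield an orthogonal g with gJ = J'g. The matrix
   1 - J'J also satisfies this relation, so that g^T (1 - J'J) commutes with J
   and has determinant at least 0: det g and det (1 - J'J) have the same sign. *)
Lemma cstruct_transitive m n (J J' : 'M[R]_m) w w' :
  m = (n.+1 + n.+1)%N -> cstruct J -> cstruct J' ->
  dot w w = 1 -> dot w' w' = 1 -> 0 < \det (1%:M - J' *m J) ->
  exists g, [/\ SO g, g *m J = J' *m g & g *m w = w'].
Proof.
move=> mE cJ cJ' ww ww' dM.
have [F [F' [e [aF aF' Fe Fe']]]] := adapted_pair mE cJ cJ' ww ww'.
subst m.
have hh := adapted_frame cJ aF; have hh' := adapted_frame cJ' aF'.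
have [[Jt JJ] [Jt' JJ']] := (cJ, cJ').
set h := row_mx F _ in hh; set h' := row_mx F' _ in hh'.
have [g gh og] : exists2 g, g *m h = h' & orth g.
  exists (h' *m h^T); first by rewrite -mulmxA hh mulmx1.
  by apply: orth_mul; [exact: mulmx1C|apply: orth_tr; exact: mulmx1C].
move: (gh); rewrite mul_mx_row => /eq_row_mx[gF gG].
have gJ : g *m J = J' *m g.
  rewrite -[LHS]mulmx1 -[RHS]mulmx1 -(mulmx1C hh) !mulmxA; congr (_ *m _).
  rewrite -!mulmxA gh /h /h' !mul_mx_row gG [J *m (J *m F)]mulmxA JJ.
  by rewrite [J' *m (J' *m F')]mulmxA JJ' !mulNmx !mul1mx mulmxN gF.
exists g; split=> //; last by rewrite -Fe mulmxA gF.
split=> //; have [//|dg] := orth_det og.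
pose M := 1%:M - J' *m J.
have JM : J' *m M = M *m J.
  rewrite mulmxBr mulmxBl mulmx1 mul1mx !mulmxA JJ' -[J' *m J *m J]mulmxA JJ.
  by rewrite mulNmx mulmxN mul1mx mulmx1 !opprK addrC.
have gJT : g^T *m J' = J *m g^T.
  apply: trmx_inj; rewrite !trmx_mul !trmxK Jt Jt' mulmxN mulNmx.
  by rewrite gJ.
have : 0 <= \det (g^T *m M).
  apply: (comm_det_ge0 erefl cJ).
  by rewrite -mulmxA -JM !mulmxA gJT.
by rewrite det_mulmx det_tr dg mulN1r oppr_ge0 leNgt dM.
Qed.

End ComplexStructures.

(** * Coordinates on the skew matrices anticommuting with J *)

Lemma smooth_linear (R : realType) (V W : normedModType R) a b (U : set V)
    (f : 'M[R]_(a, b) -> W) (g : V -> 'M[R]_(a, b)) :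
  open U -> linear f -> smooth_on U g -> smooth_on U (fun x => f (g x)).
Proof.
move=> oU lin; pose lM := GRing.isLinear.Build _ _ _ _ _ lin.
pose l : {linear _ -> _} := HB.pack f lM.
by apply: (smooth_lin oU (l := l)); apply: continuous_linear_mx.
Qed.

(** In a basis adapted to J, a skew matrix anticommuting with J has block rows
   (A, B) and (B, - A), with A and B skew. The strict upper part of A and the
   strict lower part of B can be stored in one matrix with zero diagonal. Leaving
   out the diagonal gives coordinates in the rectangular matrices with one column
   less. *)

Section SkewCoordinates.
Variables (R : realType) (n : nat).
Local Notation N := n.+1.
Implicit Types (X : 'M[R]_N) (M : 'M[R]_(N, n)).

Definition offdiag M : 'M[R]_N :=
  \matrix_(i, j) if unlift i j is Some k then M i k else 0.

Definition upper_skew X : 'M[R]_N :=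
  \matrix_(i, j) if (i < j)%N then X i j else if (j < i)%N then - X j i else 0.

Definition lower_skew X : 'M[R]_N :=
  \matrix_(i, j) if (j < i)%N then X i j else if (i < j)%N then - X j i else 0.

Definition glue_skew (A B : 'M[R]_N) : 'M[R]_(N, n) :=
  \matrix_(i, k) if (i < lift i k)%N then A i (lift i k) else B i (lift i k).

Lemma upper_skewT X : (upper_skew X)^T = - upper_skew X.
Proof.
apply/matrixP => i j; rewrite !mxE; case: ltngtP => //; rewrite ?oppr0 ?opprK //.
Qed.

Lemma lower_skewT X : (lower_skew X)^T = - lower_skew X.
Proof.
apply/matrixP => i j; rewrite !mxE; case: ltngtP => //; rewrite ?oppr0 ?opprK //.
Qed.

Lemma offdiag_lin : linear offdiag.
Proof.
move=> c X Y; apply/matrixP => i j; rewrite !mxE.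
by case: (unlift i j) => [k|]; rewrite ?mxE // mulr0 addr0.
Qed.

Lemma upper_skew_lin : linear upper_skew.
Proof.
move=> c X Y; apply/matrixP => i j; rewrite !mxE.
by case: ltngtP => _; rewrite ?mulr0 ?addr0 // opprD mulrN.
Qed.

Lemma lower_skew_lin : linear lower_skew.
Proof.
move=> c X Y; apply/matrixP => i j; rewrite !mxE.
by case: ltngtP => _; rewrite ?mulr0 ?addr0 // opprD mulrN.
Qed.

Lemma glue_skewP c (A A' B B' : 'M[R]_N) :
  glue_skew (c *: A + A') (c *: B + B') = c *: glue_skew A B + glue_skew A' B'.
Proof. by apply/matrixP => i k; rewrite !mxE; case: ifP. Qed.

Lemma glue_skewK M :
  glue_skew (upper_skew (offdiag M)) (lower_skew (offdiag M)) = M.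
Proof.
apply/matrixP => i k; rewrite !mxE liftK.
have : i != lift i k by apply: neq_lift.
by rewrite -val_eqE /=; case: ltngtP.
Qed.

Lemma skewE (A : 'M[R]_N) i j : A^T = - A -> A j i = - A i j.
Proof. by move=> /matrixP/(_ i j); rewrite !mxE. Qed.

Lemma skew_diag (A : 'M[R]_N) i : A^T = - A -> A i i = 0.
Proof.
move=> /(skewE i i) /eqP; rewrite -addr_eq0 -mulr2n mulrn_eq0 /=.
by move=> /eqP.
Qed.

Lemma offdiag_glue (A B : 'M[R]_N) i j :
  offdiag (glue_skew A B) i j =
    if (i < j)%N then A i j else if (j < i)%N then B i j else 0.
Proof.
rewrite mxE; case: unliftP => [k ->|->]; last by rewrite ltnn.
rewrite mxE; case: ifP => // /negbT; rewrite -leqNgt leq_eqVlt.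
have : lift i k != i by rewrite eq_sym neq_lift.
by rewrite -val_eqE /= => /negbTE -> /= ->.
Qed.

Lemma upper_glue (A B : 'M[R]_N) : A^T = - A ->
  upper_skew (offdiag (glue_skew A B)) = A.
Proof.
move=> At; apply/matrixP => i j; rewrite mxE !offdiag_glue.
case: ltngtP => [||/val_inj ->] //; last by rewrite skew_diag.
by rewrite (skewE i j At) opprK.
Qed.

Lemma lower_glue (A B : 'M[R]_N) : B^T = - B ->
  lower_skew (offdiag (glue_skew A B)) = B.
Proof.
move=> Bt; apply/matrixP => i j; rewrite mxE !offdiag_glue.
case: ltngtP => [||/val_inj ->] //; last by rewrite skew_diag.
by rewrite (skewE i j Bt) opprK.
Qed.

End SkewCoordinates.

Section OrbitOfComplexStructures.
Variable R : realType.

Lemma anticomm_coords m n (J : 'M[R]_m) : m = (n.+1 + n.+1)%N -> cstruct J ->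
  exists (al : 'rV[R]_(n.+1 * n) -> 'M[R]_m) (be : 'M[R]_m -> 'rV[R]_(n.+1 * n)),
    [/\ linear al, linear be,
        forall w, (al w)^T = - al w /\ al w *m J = - (J *m al w),
        cancel al be &
        forall Z, Z^T = - Z -> Z *m J = - (J *m Z) -> al (be Z) = Z].
Proof.
move=> mE cJ; have [Jt JJ] := cJ.
have [w ww _] := @orthogonal_unit R m 0 0 ltac:(by rewrite mE).
have [F [_ [_ [aF _ _ _]]]] := adapted_pair mE cJ cJ ww ww.
have [FF _] := aF; have [GF FG GG] := adapted_unitary cJ aF.
have cF := adapted_complete mE cJ aF.
set G := J *m F in GF FG GG cF.
have JG : J *m G = - F by rewrite /G mulmxA JJ mulNmx mul1mx.
have FtJ : F^T *m J = - G^T by rewrite /G trmx_mul Jt mulmxN opprK.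
have GtJ : G^T *m J = F^T.
  by rewrite -[LHS]opprK -mulmxN -Jt -trmx_mul JG linearN opprK.
have JF : J *m F = G by [].
move: G JG FtJ GtJ JF GF FG GG cF => G JG FtJ GtJ JF GF FG GG cF.
pose al0 (A B : 'M[R]_n.+1) := F *m A *m F^T + G *m B *m F^T +
  F *m B *m G^T - G *m A *m G^T.
pose al (v : 'rV[R]_(n.+1 * n)) :=
  al0 (upper_skew (offdiag (vec_mx v))) (lower_skew (offdiag (vec_mx v))).
pose be Z := mxvec (glue_skew (F^T *m Z *m F) (G^T *m Z *m F)).
exists al, be; split.
- move=> c u v; rewrite /al linearP offdiag_lin upper_skew_lin lower_skew_lin.
  set A := upper_skew _; set B := lower_skew _; set C := upper_skew _.
  set D := lower_skew _; rewrite /al0 !(mulmxDr, mulmxDl) -!(scalemxAr, scalemxAl).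
  rewrite !(scalerDr, opprD, scalerN) !addrA.
  by apply/matrixP => i j; rewrite !mxE; ring.
- move=> c Y Z; rewrite /be !(mulmxDr, mulmxDl) -!(scalemxAr, scalemxAl).
  by rewrite glue_skewP linearP.
- move=> v; rewrite /al; set A := upper_skew _; set B := lower_skew _.
  have At : A^T = - A by exact: upper_skewT.
  have Bt : B^T = - B by exact: lower_skewT.
  split.
    rewrite /al0 !linearD /= linearN /= !trmx_mul !trmxK At Bt !mulmxA.
    by rewrite !(mulmxN, mulNmx); apply/matrixP => i j; rewrite !mxE; ring.
  rewrite /al0 !(mulmxDl, mulmxDr) !(mulmxN, mulNmx) !mulmxA JF JG.
  rewrite -![_ *m F^T *m J]mulmxA -![_ *m G^T *m J]mulmxA FtJ GtJ.
  by rewrite !(mulmxN, mulNmx); apply/matrixP => i j; rewrite !mxE; ring.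
- move=> v; rewrite /be /al; set A := upper_skew _; set B := lower_skew _.
  have -> : F^T *m al0 A B *m F = A.
    rewrite /al0 !(mulmxDl, mulmxDr) !(mulmxN, mulNmx) !mulmxA FF FG !mul0mx.
    by rewrite -!mulmxA FF GF !mulmx0 mulmx1 mul1mx !addr0 subr0.
  have -> : G^T *m al0 A B *m F = B.
    rewrite /al0 !(mulmxDl, mulmxDr) !(mulmxN, mulNmx) !mulmxA GF GG !mul0mx.
    by rewrite -!mulmxA FF GF !mulmx0 mulmx1 mul1mx add0r addr0 subr0.
  by rewrite glue_skewK vec_mxK.
- move=> Z Zt ZJ; rewrite /al /be mxvecK.
  have GZF : G^T *m Z *m F = F^T *m Z *m G.
    rewrite -[in RHS]JF mulmxA -[F^T *m Z *m J]mulmxA ZJ mulmxN mulmxA FtJ.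
    by rewrite !mulNmx opprK.
  have GZG : G^T *m Z *m G = - (F^T *m Z *m F).
    rewrite -{2}JF mulmxA -[G^T *m Z *m J]mulmxA ZJ mulmxN mulmxA GtJ.
    by rewrite !mulNmx.
  rewrite upper_glue; last by rewrite !trmx_mul trmxK Zt mulNmx mulmxN mulmxA.
  rewrite lower_glue; last first.
    by rewrite !trmx_mul trmxK Zt mulNmx mulmxN mulmxA GZF.
  rewrite /al0 -[RHS]mul1mx -[RHS]mulmx1 -cF.
  have -> : - (G *m (F^T *m Z *m F) *m G^T) = G *m (G^T *m Z *m G) *m G^T.
    by rewrite GZG mulmxN mulNmx.
  rewrite [F *m (G^T *m Z *m F)]mulmxA.
  have -> : F *m (G^T *m Z) *m F = F *m (F^T *m Z *m G) by rewrite -mulmxA GZF.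
  rewrite !(mulmxDl, mulmxDr) !mulmxA.
  by rewrite -!addrA; congr (_ + _); rewrite addrCA; congr (_ + _).
Qed.

End OrbitOfComplexStructures.

(** * The adjoint action *)

Section Orbits.
Variables (R : realType) (m : nat).
Implicit Types (g x J : 'M[R]_m).

Lemma SO_orth g : SO g -> orth g. Proof. by case. Qed.

Lemma SO_mul g h : SO g -> SO h -> SO (g *m h).
Proof.
move=> [og dg] [oh dh]; split; first exact: orth_mul.
by rewrite det_mulmx dg dh mulr1.
Qed.

Lemma AdE g x : SO g -> Ad g x = g *m x *m g^T.
Proof. by move=> /SO_orth og; rewrite /Ad orth_inv. Qed.

Lemma Ad_mul g h x : SO g -> SO h -> Ad g (Ad h x) = Ad (g *m h) x.
Proof.
by move=> sg sh; rewrite !AdE //; [rewrite trmx_mul !mulmxA|exact: SO_mul].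
Qed.

Lemma AdM g x y : SO g -> Ad g (x *m y) = Ad g x *m Ad g y.
Proof.
move=> sg; rewrite !AdE // !mulmxA; congr (_ *m _ *m _).
by rewrite -[g *m x *m _ *m _]mulmxA orthT ?mulmx1 //; exact: SO_orth.
Qed.

Lemma Ad1 g : SO g -> Ad g 1%:M = 1%:M.
Proof. by move=> sg; rewrite AdE // mulmx1; case: sg. Qed.

Lemma AdT g x : SO g -> (Ad g x)^T = Ad g x^T.
Proof. by move=> sg; rewrite !AdE // !trmx_mul trmxK mulmxA. Qed.

Lemma AdN g x : SO g -> Ad g (- x) = - Ad g x.
Proof. by move=> sg; rewrite !AdE // mulmxN mulNmx. Qed.

Lemma AdD g x y : SO g -> Ad g (x + y) = Ad g x + Ad g y.
Proof. by move=> sg; rewrite !AdE // mulmxDr mulmxDl. Qed.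

Lemma AdZ g c x : SO g -> Ad g (c *: x) = c *: Ad g x.
Proof. by move=> sg; rewrite !AdE // -scalemxAr -scalemxAl. Qed.

Lemma Ad_comm g x y : SO g -> g *m x = y *m g <-> Ad g x = y.
Proof.
move=> sg; rewrite AdE //; split=> [->|<-].
  by rewrite -mulmxA (SO_orth sg) mulmx1.
by rewrite -[RHS]mulmxA orthT ?mulmx1 //; exact: SO_orth.
Qed.

Lemma Ad_cstruct g J : SO g -> cstruct J -> cstruct (Ad g J).
Proof.
by move=> sg [Jt JJ]; split; [rewrite AdT // Jt AdN|rewrite -AdM // JJ AdN // Ad1].
Qed.

Lemma orbit_Ad g x y : SO g -> adjoint_orbit x y -> adjoint_orbit x (Ad g y).
Proof.
by move=> sg [h sh <-]; exists (g *m h); [exact: SO_mul|rewrite Ad_mul].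
Qed.

Lemma orbit_cstruct J x : cstruct J -> adjoint_orbit J x -> cstruct x.
Proof. by move=> cJ [g sg <-]; apply: Ad_cstruct. Qed.

End Orbits.

(** * The chart of the orbit of a complex structure *)

Lemma inv_sym (R : realType) m (M : 'M[R]_m) : M \in unitmx ->
  M^T *m M = M + M^T -> (invmx M)^T + invmx M = 1%:M.
Proof.
move=> uM E; have uMt : M^T \in unitmx by rewrite unitmx_tr.
rewrite trmx_inv; apply: (can_inj (mulKmx uMt)); apply: (can_inj (mulmxK uM)).
rewrite mulmxDr mulmxV // mulmx1 mulmxDl mul1mx -[in LHS]mulmxA mulVmx //.
by rewrite mulmx1 E.
Qed.

Lemma inv_intertwine (R : realType) m (M J : 'M[R]_m) : M \in unitmx ->
  J *m M + M *m J = M *m J *m M -> invmx M *m J + J *m invmx M = J.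
Proof.
move=> uM E; apply: (can_inj (mulKmx uM)); apply: (can_inj (mulmxK uM)).
rewrite mulmxDr mulmxDl mulmxA mulmxV // mul1mx -!mulmxA mulVmx // mulmx1.
by rewrite E mulmxA.
Qed.

Section ChartComplexStructures.
Variables (R : realType) (m n : nat).
Hypothesis mE : m = (n.+1 + n.+1)%N.
Variables (J : 'M[R]_m).
Hypothesis cJ : cstruct J.
Let Jt : J^T = - J := cJ.1.
Let JJ : J *m J = - 1%:M := cJ.2.

(** Up to the factor 2, the matrix 1 - qJ recovers the conjugating matrix
   (1 - Z)^-1 from q, whence the coordinate Z = 1 - 2 (1 - qJ)^-1. In terms of
   the Cayley transform, q = (1 - Z)^-1 (1 + Z) J. *)
Definition cs_chart (Z : 'M[R]_m) := invmx (1%:M - Z) *m J *m (1%:M - Z).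
Definition cs_trans (q : 'M[R]_m) := 1%:M - q *m J.
Definition cs_coord (q : 'M[R]_m) := 1%:M - 2 *: invmx (cs_trans q).

Section FromCoord.
Variable Z : 'M[R]_m.
Hypotheses (Zt : Z^T = - Z) (ZJ : Z *m J = - (J *m Z)).
Let A := 1%:M - Z.

Lemma cs_unit : A \in unitmx. Proof. exact: skew_unit. Qed.

Lemma cs_unitP : 1%:M + Z \in unitmx.
Proof. by rewrite -unitmx_tr linearD /= trmx1 Zt cs_unit. Qed.

Lemma cs_chartE : cs_chart Z = invmx A *m (1%:M + Z) *m J.
Proof.
rewrite /cs_chart -!mulmxA; congr (_ *m _).
by rewrite mulmxBr mulmxDl mulmx1 mul1mx ZJ.
Qed.

Lemma cs_chart_cstruct : cstruct (cs_chart Z).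
Proof.
have uA := cs_unit; have uB := cs_unitP; split; last first.
  rewrite /cs_chart -!mulmxA (mulmxA A) mulmxV // mul1mx (mulmxA J) JJ.
  by rewrite mulNmx mul1mx mulmxN mulVmx.
have AB : A^T = 1%:M + Z by rewrite linearB /= trmx1 Zt opprK.
rewrite /cs_chart !trmx_mul trmx_inv -/A AB Jt mulNmx mulmxN; congr (- _).
rewrite -/(cs_chart Z) cs_chartE.
apply: (can_inj (mulKmx uA)).
rewrite -!mulmxA mulKVmx // !mulmxA.
have -> : A *m (1%:M + Z) = (1%:M + Z) *m A.
  by rewrite mulmxDr mulmx1 mulmxDl mul1mx mulmxBl mulmxBr mul1mx mulmx1.
rewrite -!mulmxA; congr (_ *m _).
apply: (can_inj (mulmxK uB)); rewrite -!mulmxA mulVmx // mulmx1.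
by rewrite mulmxDr mulmx1 mulmxBl mul1mx ZJ opprK.
Qed.

Lemma cs_trans_chart : cs_trans (cs_chart Z) = 2 *: invmx A.
Proof.
rewrite /cs_trans cs_chartE -[_ *m J *m J]mulmxA JJ mulmxN mulmx1 opprK.
rewrite -{1}(mulVmx cs_unit) -mulmxDr (_ : 1%:M - Z + (1%:M + Z) = 2%:M).
  by rewrite mul_mx_scalar.
by rewrite addrC addrACA subrr addr0 -raddfD.
Qed.

Lemma cs_trans_det : 0 < \det (cs_trans (cs_chart Z)).
Proof.
rewrite cs_trans_chart detZ mulr_gt0 ?exprn_gt0 //.
by rewrite det_inv invr_gt0 skew_det_gt0.
Qed.

Lemma cs_chartK : cs_coord (cs_chart Z) = Z.
Proof.
rewrite /cs_coord cs_trans_chart invmxZ; last first.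
  by rewrite unitmxZ ?unitmx_inv ?cs_unit // unitfE pnatr_eq0.
by rewrite invmxK scalerA divff ?pnatr_eq0 // scale1r /A opprB addrC subrK.
Qed.

End FromCoord.

Section ToCoord.
Variable q : 'M[R]_m.
Hypotheses (cq : cstruct q) (uq : cs_trans q \in unitmx).
Let M := cs_trans q.

Lemma cs_trans_intertwine : q *m M = M *m J.
Proof.
rewrite mulmxBr mulmxBl mulmx1 mul1mx mulmxA cq.2 -mulmxA JJ.
by rewrite mulNmx mulmxN mulmx1 mul1mx !opprK addrC.
Qed.

(** With the invertibility of M, this says that M^-1 + (M^-1)^T = 1, that is,
   1 - 2 M^-1 is skew. *)
Lemma cs_trans_sym : M^T *m M = M + M^T.
Proof.
have Mt : M^T = 1%:M - J *m q.
  by rewrite linearB /= trmx1 trmx_mul Jt cq.1 mulNmx mulmxN opprK.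
rewrite Mt mulmxBl mul1mx [in X in _ - X]mulmxBr mulmx1 !mulmxA.
rewrite -[J *m q *m q]mulmxA cq.2 mulmxN mulmx1 mulNmx JJ opprK.
by rewrite opprB.
Qed.

Lemma cs_coord_skew : (cs_coord q)^T = - cs_coord q.
Proof.
have S := inv_sym uq cs_trans_sym.
rewrite /cs_coord linearB /= trmx1 linearZ /= -/M.
move: S; rewrite -/M; move: (invmx M) => X <-.
by apply/matrixP => i j; rewrite !mxE; ring.
Qed.

Lemma cs_coord_anticomm : cs_coord q *m J = - (J *m cs_coord q).
Proof.
rewrite /cs_coord mulmxBl mulmxBr mul1mx mulmx1 -scalemxAl -scalemxAr -/M.
have S : invmx M *m J + J *m invmx M = J.
  apply: inv_intertwine => //.
  have MJ : M *m J = J + q.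
    by rewrite mulmxBl mul1mx -mulmxA JJ mulmxN mulmx1 opprK.
  by rewrite [in RHS]MJ [in RHS]mulmxDl cs_trans_intertwine.
move: (invmx M *m J) (J *m invmx M) S => X Y <-.
by apply/matrixP => i j; rewrite !mxE; ring.
Qed.

Lemma cs_coordK : cs_chart (cs_coord q) = q.
Proof.
have E : 1%:M - cs_coord q = 2 *: invmx M.
  by rewrite /cs_coord opprB addrC subrK.
have u2 : 2 *: invmx M \in unitmx.
  by rewrite unitmxZ ?unitmx_inv // unitfE pnatr_eq0.
rewrite /cs_chart E invmxZ // invmxK -scalemxAl -scalemxAr -scalemxAl scalerA.
rewrite divff ?pnatr_eq0 // scale1r -cs_trans_intertwine -mulmxA.
by rewrite mulmxV // mulmx1.
Qed.

End ToCoord.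
End ChartComplexStructures.

Section CsSmooth.
Variables (R : realType) (m : nat) (V : normedModType R) (U : set V).
Hypothesis oU : open U.

Lemma smooth_sub a b (f g : V -> 'M[R]_(a, b)) :
  smooth_on U f -> smooth_on U g -> smooth_on U (fun x => f x - g x).
Proof. by move=> sf sg; apply: smooth_add => //; apply: smooth_opp. Qed.

Lemma smooth_cs_chart (J : 'M[R]_m) (f : V -> 'M[R]_m) :
  (forall x, U x -> (f x)^T = - f x) ->
  smooth_on U f -> smooth_on U (fun x => cs_chart J (f x)).
Proof.
move=> ft sf; have s1 : smooth_on U (fun x => 1%:M - f x).
  by apply: smooth_sub => //; apply: smooth_cst.
apply: smooth_mulmx => //; apply: smooth_mulmx => //; last exact: smooth_cst.
by apply: smooth_invmx => // x Ux; apply: skew_unit; apply: ft.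
Qed.

Lemma smooth_cs_trans (J : 'M[R]_m) (f : V -> 'M[R]_m) :
  smooth_on U f -> smooth_on U (fun x => cs_trans J (f x)).
Proof.
move=> sf; apply: smooth_sub => //; first exact: smooth_cst.
by apply: smooth_mulmx => //; apply: smooth_cst.
Qed.

Lemma smooth_cs_coord (J : 'M[R]_m) (f : V -> 'M[R]_m) :
  (forall x, U x -> cs_trans J (f x) \in unitmx) ->
  smooth_on U f -> smooth_on U (fun x => cs_coord J (f x)).
Proof.
move=> uf sf; apply: smooth_sub => //; first exact: smooth_cst.
apply: smooth_scale => //; first exact: smooth_cst.
by apply: smooth_invmx => //; apply: smooth_cs_trans.
Qed.

End CsSmooth.

Section OrbitCs.
Variables (R : realType) (m n : nat).
Hypothesis mE : m = (n.+1 + n.+1)%N.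

Lemma orbit_trans (x y z : 'M[R]_m) :
  adjoint_orbit x y -> adjoint_orbit y z -> adjoint_orbit x z.
Proof. by move=> xy [g sg <-]; apply: orbit_Ad. Qed.

Lemma cs_trans_self (J : 'M[R]_m) : cstruct J -> cs_trans J J = 2%:M.
Proof. by case=> _ JJ; rewrite /cs_trans JJ opprK -raddfD. Qed.

Lemma cs_trans_self_det (J : 'M[R]_m) : cstruct J -> \det (cs_trans J J) != 0.
Proof. by move=> /cs_trans_self ->; rewrite det_scalar expf_neq0 ?pnatr_eq0. Qed.

Lemma submanifold_cstruct (J : 'M[R]_m) : cstruct J ->
  submanifold (n.+1 * n) (adjoint_orbit J).
Proof.
move=> cJ; apply: chart_submanifold => p Jp.
have cp := orbit_cstruct cJ Jp.
have [al [be [alin belin alP alK beK]]] := anticomm_coords mE cp.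
have [w ww _] := @orthogonal_unit R m 0 0 ltac:(by rewrite mE).
exists (fun q => \det (cs_trans p q)), (fun v => cs_chart p (al v)).
exists (fun q => be (cs_coord p q)).
have sh : smooth_on setT (fun q => \det (cs_trans p q)).
  apply: smooth_det; first exact: openT.
  by apply: smooth_cs_trans; [exact: openT|exact: (smooth_id openT)].
have oU := open_neq0 sh.
split; split=> //.
- exact: cs_trans_self_det.
- apply: smooth_cs_chart; [exact: openT|by move=> v _; case: (alP v)|].
  by apply: (smooth_linear openT alin); apply: (smooth_id openT).
- apply: (smooth_linear oU belin); apply: smooth_cs_coord => //.
    by move=> q /=; rewrite unitmxE unitfE.
  exact: smooth_id.
- move=> v; have [t a] := alP v.
  have cq := cs_chart_cstruct cp t a.
  have [g [sg gp _]] := cstruct_transitive mE cp cq ww ww (cs_trans_det cp t a).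
  by apply: orbit_trans Jp _; exists g => //; apply/Ad_comm.
- move=> q Jq; rewrite -unitfE -unitmxE => uq.
  have cq := orbit_cstruct cJ Jq.
  rewrite beK; first exact: cs_coordK.
    exact: cs_coord_skew.
  exact: cs_coord_anticomm.
- by move=> v _; have [t a] := alP v; rewrite cs_chartK.
Qed.

End OrbitCs.

(** * The chart of the orbit of a complex structure with a complex line *)

Section ComplexLines.
Variables (R : realType) (m : nat).
Implicit Types (J Q : 'M[R]_m) (w v : 'cV[R]_m).

(** The product of the vector w by a + ib, for the complex structure J. *)
Definition cscale J (a b : R) w := a *: w + b *: (J *m w).

(** The orthogonal projector onto the complex line through w. *)
Definition cline J w : 'M[R]_m :=
  (dot w w)^-1 *: (w *m w^T + (J *m w) *m (J *m w)^T).

Lemma clineE J w v :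
  cline J w *m v = cscale J (dot w v / dot w w) (dot (J *m w) v / dot w w) w.
Proof.
by rewrite -scalemxAl mulmxDl !rank1_mul scalerDr !scalerA ![_^-1 * _]mulrC.
Qed.

Lemma cscale_mul J a b c d w : J *m J = - 1%:M ->
  cscale J a b (cscale J c d w) = cscale J (a * c - b * d) (a * d + b * c) w.
Proof.
move=> JJ; rewrite /cscale mulmxDr -!scalemxAr mulmxA JJ mulNmx mul1mx.
by apply/matrixP => i j; rewrite !mxE; ring.
Qed.

Lemma cscale_real J a w : cscale J a 0 w = a *: w.
Proof. by rewrite /cscale scale0r addr0. Qed.

Lemma intertwine_cscale J J' g a b w : g *m J = J' *m g ->
  g *m cscale J a b w = cscale J' a b (g *m w).
Proof.
by move=> gJ; rewrite /cscale mulmxDr -!scalemxAr !mulmxA gJ.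
Qed.

Lemma sqr2_eq0 (a b : R) : (a * a + b * b == 0) = (a == 0) && (b == 0).
Proof. by rewrite -!expr2 paddr_eq0 ?sqr_ge0 // !sqrf_eq0. Qed.

Lemma dot_cscale J a b w : cstruct J ->
  dot (cscale J a b w) (cscale J a b w) = (a * a + b * b) * dot w w.
Proof.
move=> cJ; rewrite /cscale !dotL cstruct_dot // (dotC (J *m w) w).
rewrite skew_dot; last by case: cJ.
by ring.
Qed.

Lemma cline_cscale J a b w : cstruct J -> a * a + b * b != 0 ->
  cline J (cscale J a b w) = cline J w.
Proof.
move=> cJ ab; rewrite /cline dot_cscale // invfM mulrC -scalerA; congr (_ *: _).
have -> : J *m cscale J a b w = - b *: w + a *: (J *m w).
  rewrite /cscale mulmxDr -!scalemxAr mulmxA cJ.2 mulNmx mul1mx scalerN.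
  by rewrite -scaleNr addrC.
rewrite /cscale; move: (J *m w) => u; apply: (scalerI ab).
rewrite [LHS]scalerA divff // scale1r.
rewrite !linearD /= !linearZ /= !(mulmxDl, mulmxDr) -!(scalemxAl, scalemxAr).
by apply/matrixP => i j; rewrite !mxE; ring.
Qed.

Lemma cline_scale J c w : cstruct J -> c != 0 -> cline J (c *: w) = cline J w.
Proof.
move=> cJ c0; rewrite -(cscale_real J) cline_cscale // mulr0 addr0.
by rewrite mulf_neq0.
Qed.

Lemma Ad_cline g J w : SO g -> Ad g (cline J w) = cline (Ad g J) (g *m w).
Proof.
move=> sg; have og := SO_orth sg; rewrite AdZ // /cline orth_dot //.
congr (_ *: _); rewrite AdD // !AdE // -[g *m J *m g^T *m (g *m w)]mulmxA.
by rewrite [g^T *m (g *m w)]mulmxA orthT // mul1mx !trmx_mul !mulmxA.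
Qed.

(** The point of the product of the three orbits given by a complex structure J
   and the projector Q onto a J-complex line. Its components are J_x + J_y,
   J_x - J_y and - 2 J_x for the components J_x = JQ and J_y = J (1 - Q) of J, so
   that they add up to zero. *)
Definition triple J Q : 'M[R]_m * 'M[R]_m * 'M[R]_m :=
  (J, 2 *: (J *m Q) - J, (- 2) *: (J *m Q)).

Definition Ad3 g (p : 'M[R]_m * 'M[R]_m * 'M[R]_m) :=
  (Ad g p.1.1, Ad g p.1.2, Ad g p.2).

Lemma Ad3_triple g J Q : SO g -> Ad3 g (triple J Q) = triple (Ad g J) (Ad g Q).
Proof.
by move=> sg; rewrite /Ad3 /triple /= AdD // AdN // !AdZ // !AdM.
Qed.

Lemma invmx_adj (M : 'M[R]_m) : M \in unitmx -> \adj M = \det M *: invmx M.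
Proof.
move=> uM; have d0 : \det M != 0 by rewrite -unitfE -unitmxE.
by rewrite /invmx uM scalerA divff // scale1r.
Qed.

End ComplexLines.

Section OrbitL.
Variables (R : realType) (m n : nat).
Hypothesis mE : m = (n.+1 + n.+1)%N.

Lemma complex_line_complement (J : 'M[R]_m) w : cstruct J -> dot w w = 1 ->
  exists N : 'M[R]_(m, n + n), [/\ N^T *m N = 1%:M, N^T *m w = 0, N^T *m (J *m w) = 0 &
    w *m w^T + (J *m w) *m (J *m w)^T + N *m N^T = 1%:M].
Proof.
move=> cJ ww; have mE' : m = ((1 + 1) + (n + n))%N by rewrite mE; lia.
move: w ww J cJ; clear mE; subst m => w ww J cJ.
have AA : (row_mx w (J *m w))^T *m row_mx w (J *m w) = 1%:M.
  by apply: (@adapted_frame _ _ 1 J w) => //; apply: adapted1.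
have [N [NN NA AN]] := frame_complement AA.
exists N; split => //.
- by move: NA; rewrite mul_mx_row => /eqP; rewrite row_mx_eq0 => /andP[/eqP].
- by move: NA; rewrite mul_mx_row => /eqP; rewrite row_mx_eq0 => /andP[_ /eqP].
by rewrite -AN tr_row_mx mul_row_col.
Qed.

Variables (J : 'M[R]_m) (w : 'cV[R]_m).
Hypotheses (cJ : cstruct J) (ww : dot w w = 1).

(** The columns of N are an orthonormal basis of the orthogonal of the J-complex
   line of w, and al, be are linear coordinates on the skew matrices
   anticommuting with J. A point of the chart is a complex structure q with the
   q-complex line of [fl_y] = (1 - Z)^-1 [fl_x]. Conversely the projector Q' of
   the line is half of q times the third component; since 1 - qJ intertwines J
   and q, the vector [fl_u], the image of Q' w by the adjugate of 1 - qJ, is a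
   complex multiple of [fl_x]. Its coefficient is [fl_re] + i [fl_im], as [fl_x] has
   coordinate 1 along w, and [fl_coord] divides by it. The adjugate replaces the
   inverse in order that [fl_h] be polynomial. *)

Section Chart.
Variable N : 'M[R]_(m, n + n).
Hypotheses (NN : N^T *m N = 1%:M) (Nw : N^T *m w = 0) (NJw : N^T *m (J *m w) = 0)
  (NC : w *m w^T + (J *m w) *m (J *m w)^T + N *m N^T = 1%:M).
Variables (al : 'rV[R]_(n.+1 * n) -> 'M[R]_m) (be : 'M[R]_m -> 'rV[R]_(n.+1 * n)).
Hypotheses (alin : linear al) (belin : linear be)
 (alP : forall v, (al v)^T = - al v /\ al v *m J = - (J *m al v))
 (alK : cancel al be)
 (beK : forall Z, Z^T = - Z -> Z *m J = - (J *m Z) -> al (be Z) = Z).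

Let V := ('M[R]_m * 'M[R]_m * 'M[R]_m)%type.

Definition fl_x (v : 'rV[R]_(n.+1 * n + (n + n))) : 'cV[R]_m :=
  w + N *m (rsubmx v)^T.
Definition fl_y v : 'cV[R]_m := invmx (1%:M - al (lsubmx v)) *m fl_x v.
Definition fl_chart v : V :=
  let q := cs_chart J (al (lsubmx v)) in triple q (cline q (fl_y v)).

Definition fl_u (t : V) : 'cV[R]_m :=
  \adj (cs_trans J t.1.1) *m (2^-1 *: (t.1.1 *m t.2)) *m w.
Definition fl_re t := dot w (fl_u t).
Definition fl_im t := dot (J *m w) (fl_u t).
Definition fl_norm t := fl_re t * fl_re t + fl_im t * fl_im t.
Definition fl_h (t : V) := \det (cs_trans J t.1.1) * fl_norm t.
Definition fl_coord t : 'cV[R]_m :=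
  (fl_norm t)^-1 *: cscale J (fl_re t) (- fl_im t) (fl_u t).
Definition fl_inv (t : V) : 'rV[R]_(n.+1 * n + (n + n)) :=
  row_mx (be (cs_coord J t.1.1)) (N^T *m fl_coord t)^T.

Lemma dot_mul0 (z : 'cV[R]_m) u : N^T *m z = 0 -> dot z (N *m u) = 0.
Proof. by move=> H; rewrite dotC /dot trmx_mul -mulmxA H mulmx0 mxE. Qed.

Lemma dot_w_x v : dot w (fl_x v) = 1.
Proof. by rewrite /fl_x dotDr ww dot_mul0 // addr0. Qed.

Lemma dot_Jw_x v : dot (J *m w) (fl_x v) = 0.
Proof.
rewrite /fl_x dotDr dot_mul0 // addr0 dotC skew_dot //.
by case: cJ.
Qed.

Lemma dot_w_Jx v : dot w (J *m fl_x v) = 0.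
Proof. by rewrite dotC dot_mull cJ.1 mulNmx dotNr dotC dot_Jw_x oppr0. Qed.

Lemma fl_x_neq0 v : fl_x v != 0.
Proof.
apply/eqP => x0; have := dot_w_x v.
by rewrite x0 dot0r => /esym/eqP; rewrite oner_eq0.
Qed.

Lemma cscale_divK a b (z : 'cV[R]_m) : a * a + b * b != 0 ->
  (a * a + b * b)^-1 *: cscale J a (- b) (cscale J a b z) = z.
Proof.
move=> ab; rewrite cscale_mul ?cJ.2 // mulNr opprK mulNr [b * a]mulrC subrr.
by rewrite cscale_real scalerA mulVf // scale1r.
Qed.

Section FromChart.
Variable v : 'rV[R]_(n.+1 * n + (n + n)).
Let Z := al (lsubmx v).
Let Zt : Z^T = - Z. Proof. by case: (alP (lsubmx v)). Qed.
Let ZJ : Z *m J = - (J *m Z). Proof. by case: (alP (lsubmx v)). Qed.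
Let q := cs_chart J Z.
Let cq : cstruct q. Proof. exact: cs_chart_cstruct. Qed.
Let uA : 1%:M - Z \in unitmx. Proof. exact: skew_unit. Qed.

Lemma fl_y_neq0 : fl_y v != 0.
Proof.
apply: contra (fl_x_neq0 v) => /eqP y0.
by rewrite -[fl_x v](mulKVmx uA) -/(fl_y v) y0 mulmx0.
Qed.

Lemma fl_chart_orbit : exists2 g, SO g & fl_chart v = Ad3 g (triple J (cline J w)).
Proof.
have [c c0 yy] := exists_unit fl_y_neq0.
have [g [sg gJ gw]] :=
  cstruct_transitive mE cJ cq ww yy (cs_trans_det cJ Zt ZJ).
exists g => //; rewrite Ad3_triple // Ad_cline // gw cline_scale ?gt_eqF //.
  by move/(Ad_comm J q sg): gJ => ->.
exact: Ad_cstruct.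
Qed.

Lemma fl_chartK : fl_h (fl_chart v) != 0 -> fl_inv (fl_chart v) = v.
Proof.
set t := fl_chart v; rewrite mulf_eq0 negb_or => /andP[_ h0].
have t1 : t.1.1 = q by [].
have [a [b uE]] : exists a b, fl_u t = cscale J a b (fl_x v).
  pose d := \det (cs_trans J q).
  have uM : cs_trans J q \in unitmx.
    by rewrite unitmxE unitfE gt_eqF // cs_trans_det.
  exists (d * 2^-1 * (dot (fl_y v) w / dot (fl_y v) (fl_y v))).
  exists (d * 2^-1 * (dot (q *m fl_y v) w / dot (fl_y v) (fl_y v))).
  have -> : fl_u t = \adj (cs_trans J q) *m cline q (fl_y v) *m w.
    rewrite /fl_u t1 /t /=; congr (_ *m _ *m _).
    by rewrite -scalemxAr mulmxA cq.2 scalerA mulNmx mul1mx scalerN -scaleNr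
      mulrN opprK mulVf ?pnatr_eq0 // scale1r.
  rewrite invmx_adj // (cs_trans_chart cJ Zt ZJ) invmxZ; last first.
    by rewrite -(cs_trans_chart cJ Zt ZJ).
  rewrite invmxK -(cs_trans_chart cJ Zt ZJ) -/q -/d -!scalemxAl scalerA.
  rewrite -mulmxA clineE (@intertwine_cscale _ _ q J); last first.
    by rewrite /q /cs_chart -mulmxA mulKVmx.
  rewrite /fl_y mulKVmx // -/(fl_y v) /cscale scalerDr !scalerA.
  by [].
have re : fl_re t = a.
  by rewrite /fl_re uE dotDr !dotZr dot_w_x dot_w_Jx mulr1 mulr0 addr0.
have im : fl_im t = b.
  by rewrite /fl_im uE dotDr !dotZr dot_Jw_x cstruct_dot // dot_w_x mulr1 mulr0 add0r.
rewrite /fl_inv /fl_coord /fl_norm re im uE.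
rewrite /fl_norm re im in h0.
rewrite cscale_divK // /fl_x mulmxDr Nw add0r mulmxA NN mul1mx trmxK.
by rewrite t1 /q cs_chartK // alK hsubmxK.
Qed.

End FromChart.

Section ToChart.
Variables (q : 'M[R]_m) (w1 : 'cV[R]_m).
Hypothesis cq : cstruct q.
Let t := triple q (cline q w1).

Lemma fl_uE : fl_u t = \adj (cs_trans J q) *m (cline q w1 *m w).
Proof.
rewrite /fl_u -mulmxA; congr (_ *m (_ *m _)).
by rewrite /t /= -scalemxAr mulmxA cq.2 scalerA mulNmx mul1mx scalerN -scaleNr
  mulrN opprK mulVf ?pnatr_eq0 // scale1r.
Qed.

Lemma fl_coord_decomp : fl_norm t != 0 ->
  w + N *m (N^T *m fl_coord t) = fl_coord t.
Proof.
(* By construction fl_coord t has complex coordinate 1 along w. *)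
move=> n0; rewrite -[RHS]mul1mx -NC !mulmxDl !rank1_mul mulmxA.
have -> : dot w (fl_coord t) = 1.
  rewrite dotZr dotDr !dotZr -/(fl_re t).
  have -> : dot w (J *m fl_u t) = - fl_im t.
    by rewrite dotC dot_mull cJ.1 mulNmx dotNr dotC.
  by rewrite mulrNN mulVf.
have -> : dot (J *m w) (fl_coord t) = 0.
  rewrite dotZr dotDr !dotZr -/(fl_im t) cstruct_dot // -/(fl_re t).
  by rewrite mulNr [fl_im t * _]mulrC subrr mulr0.
by rewrite scale1r scale0r addr0.
Qed.

Lemma fl_invK : fl_h t != 0 -> fl_chart (fl_inv t) = t.
Proof.
rewrite mulf_eq0 negb_or => /andP[d0 n0].
have uM : cs_trans J q \in unitmx by rewrite unitmxE unitfE.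
have lE : al (lsubmx (fl_inv t)) = cs_coord J q.
  rewrite row_mxKl beK //; first exact: cs_coord_skew.
  exact: cs_coord_anticomm.
have xE : fl_x (fl_inv t) = fl_coord t.
  by rewrite /fl_x row_mxKr trmxK fl_coord_decomp.
rewrite /fl_chart /fl_y lE xE cs_coordK //.
congr (triple q _).
pose a := dot w1 w / dot w1 w1; pose b := dot (q *m w1) w / dot w1 w1.
pose d := \det (cs_trans J q).
have uE : fl_u t = d *: (invmx (cs_trans J q) *m cscale q a b w1).
  by rewrite fl_uE invmx_adj // -scalemxAl clineE.
have ab : a * a + b * b != 0.
  apply: contra n0; rewrite sqr2_eq0 => /andP[/eqP a0 /eqP b0].
  have u0 : fl_u t = 0.
    by rewrite uE a0 b0 /cscale !scale0r addr0 mulmx0 scaler0.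
  by rewrite /fl_norm /fl_re /fl_im u0 !dot0r mulr0 addr0.
have AE : invmx (1%:M - cs_coord J q) = 2^-1 *: cs_trans J q.
  rewrite /cs_coord opprB addrC subrK invmxZ ?invmxK //.
  by rewrite unitmxZ ?unitmx_inv // unitfE pnatr_eq0.
rewrite AE /fl_coord -scalemxAl -scalemxAr.
rewrite (@intertwine_cscale _ _ J q); last exact/esym/cs_trans_intertwine.
rewrite uE -[cs_trans J q *m _]scalemxAr mulKVmx //.
rewrite -[d *: _](cscale_real q) !cscale_mul ?cq.2 //.
rewrite scalerA cline_scale //; last first.
  by rewrite mulf_neq0 ?invr_eq0 ?pnatr_eq0.
rewrite -!cscale_mul ?cq.2 // !cline_cscale //.
- by rewrite mulr0 addr0 mulf_neq0.
- by rewrite mulrNN.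
Qed.

End ToChart.

Lemma fl_h_base : fl_h (triple J (cline J w)) != 0.
Proof.
rewrite /fl_h mulf_neq0 ?cs_trans_self_det // /fl_norm.
have w0 : dot w w != 0 by rewrite ww oner_neq0.
have u2 : 2%:M \in @unitmx R m.
  by rewrite unitmxE unitfE det_scalar expf_neq0 ?pnatr_eq0.
have uE : fl_u (triple J (cline J w)) = (\det (2%:M : 'M[R]_m) / 2) *: w.
  rewrite fl_uE // cs_trans_self // invmx_adj // -scalemxAl invmx_scalar.
  rewrite mul_scalar_mx scalerA clineE ww !divr1.
  rewrite dotC skew_dot ?cscale_real ?scale1r //.
  by case: cJ.
rewrite /fl_re /fl_im uE !dotZr ww mulr1 dotC skew_dot; last by case: cJ.
rewrite !mulr0 addr0 mulf_neq0 // mulf_neq0 ?invr_eq0 ?pnatr_eq0 //.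
  by rewrite det_scalar expf_neq0 ?pnatr_eq0.
by rewrite det_scalar expf_neq0 ?pnatr_eq0.
Qed.

Lemma smooth_triple (W : normedModType R) (U : set W) (f g : W -> 'M[R]_m) :
  open U -> smooth_on U f -> smooth_on U g ->
  smooth_on U (fun x => triple (f x) (g x)).
Proof.
move=> oU sf sg; have sfg : smooth_on U (fun x => f x *m g x).
  exact: smooth_mulmx.
apply: smooth_pair => //; last by apply: smooth_scale => //; apply: smooth_cst.
apply: smooth_pair => //; apply: smooth_sub => //.
by apply: smooth_scale => //; apply: smooth_cst.
Qed.

Lemma smooth_dot (W : normedModType R) (U : set W) (f g : W -> 'cV[R]_m) :
  open U -> smooth_on U f -> smooth_on U g ->
  smooth_on U (fun x => dot (f x) (g x)).
Proof.
move=> oU sf sg; apply: smooth_entry => //; apply: smooth_mulmx => //.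
exact: smooth_trmx.
Qed.

Lemma smooth_fl_chart : smooth_on setT fl_chart.
Proof.
have oT := @openT 'rV[R]_(n.+1 * n + (n + n)).
have sid := smooth_id oT.
have sZ : smooth_on setT (fun v : 'rV[R]_(n.+1 * n + (n + n)) => al (lsubmx v)).
  apply: (smooth_linear oT alin).
  apply: (smooth_linear oT (f := lsubmx) _ sid).
  by move=> c x y; rewrite linearP.
have sx : smooth_on setT fl_x.
  apply: smooth_add => //; first exact: smooth_cst.
  apply: smooth_mulmx => //; first exact: smooth_cst.
  apply: smooth_trmx => //.
  apply: (smooth_linear oT (f := rsubmx) _ sid).
  by move=> c x y; rewrite linearP.
have sy : smooth_on setT fl_y.
  apply: smooth_mulmx => //; apply: smooth_invmx => //.
    by move=> v _; apply: skew_unit; case: (alP (lsubmx v)).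
  by apply: smooth_sub => //; apply: smooth_cst.
have sq : smooth_on setT
    (fun v : 'rV[R]_(n.+1 * n + (n + n)) => cs_chart J (al (lsubmx v))).
  by apply: smooth_cs_chart => // v _; case: (alP (lsubmx v)).
apply: smooth_triple => //; apply: smooth_scale => //.
  apply: smooth_inv => //; last exact: smooth_dot.
  by move=> v _; rewrite dot_eq0 fl_y_neq0.
apply: smooth_add => //; apply: smooth_mulmx => //; try exact: smooth_trmx.
  exact: smooth_mulmx.
by apply: smooth_trmx => //; apply: smooth_mulmx.
Qed.

Section SmoothInverse.
Variable U : set V.
Hypothesis oU : open U.
Let s1 : smooth_on U (fun t : V => t.1.1).
Proof. by do 2!apply: smooth_fst => //; apply: smooth_id. Qed.
Let s2 : smooth_on U (fun t : V => t.2).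
Proof. by apply: smooth_snd => //; apply: smooth_id. Qed.

Let smooth_fl_u : smooth_on U fl_u.
Proof.
apply: smooth_mulmx => //; last exact: smooth_cst.
apply: smooth_mulmx => //; first by apply: smooth_adj => //; apply: smooth_cs_trans.
by apply: smooth_scale => //; [exact: smooth_cst|exact: smooth_mulmx].
Qed.

Let smooth_re : smooth_on U fl_re.
Proof. by apply: smooth_dot => //; apply: smooth_cst. Qed.

Let smooth_im : smooth_on U fl_im.
Proof. by apply: smooth_dot => //; apply: smooth_cst. Qed.

Let smooth_norm : smooth_on U fl_norm.
Proof. by apply: smooth_add => //; apply: smooth_mul. Qed.

Lemma smooth_fl_h : smooth_on U fl_h.
Proof.
by apply: smooth_mul => //; apply: smooth_det => //; apply: smooth_cs_trans.
Qed.

Lemma smooth_fl_inv : (forall t, U t -> fl_h t != 0) -> smooth_on U fl_inv.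
Proof.
move=> h0; apply: smooth_row_mx => //.
  apply: (smooth_linear oU belin); apply: smooth_cs_coord => // t /h0.
  by rewrite mulf_eq0 negb_or unitmxE unitfE => /andP[].
apply: smooth_trmx => //; apply: smooth_mulmx => //; first exact: smooth_cst.
apply: smooth_scale => //.
  by apply: smooth_inv => // t /h0; rewrite mulf_eq0 negb_or => /andP[].
apply: smooth_add => //; apply: smooth_scale => //; last first.
  by apply: smooth_mulmx => //; apply: smooth_cst.
apply: (smooth_ext oU (f := fun t => -1 * fl_im t)).
  by move=> t _; rewrite mulN1r.
by apply: smooth_mul => //; apply: smooth_cst.
Qed.

End SmoothInverse.
End Chart.
End OrbitL.

Section FlagSubmanifold.
Variables (R : realType) (m n : nat).
Hypothesis mE : m = (n.+1 + n.+1)%N.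

Lemma submanifold_triple (J : 'M[R]_m) (w : 'cV[R]_m) : cstruct J -> dot w w = 1 ->
  submanifold (n.+1 * n + (n + n))
    [set Ad3 g (triple J (cline J w)) | g in @SO R m].
Proof.
move=> cJ0 ww0; apply: chart_submanifold => p [g0 sg0].
rewrite Ad3_triple // Ad_cline //.
set J' := Ad g0 J; set w' := g0 *m w => pE.
have cJ' : cstruct J' by exact: Ad_cstruct.
have ww' : dot w' w' = 1 by rewrite orth_dot //; exact: SO_orth.
have [al [be [alin belin alP alK beK]]] := anticomm_coords mE cJ'.
have [N [NN Nw NJw NC]] := complex_line_complement mE cJ' ww'.
exists (fl_h J' w'), (fl_chart J' w' N al), (fl_inv J' w' N be).
have sh := smooth_fl_h J' w' openT.
have oU := open_neq0 sh.
split; split=> //.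
- rewrite -pE; exact: fl_h_base.
- exact: smooth_fl_chart.
- exact: smooth_fl_inv.
- move=> v; have [g sg ->] := fl_chart_orbit mE cJ' ww' Nw alP v.
  exists (g *m g0); first exact: SO_mul.
  have E : triple J' (cline J' w') = Ad3 g0 (triple J (cline J w)).
    by rewrite Ad3_triple // Ad_cline.
  by rewrite E /Ad3 /= !Ad_mul.
- move=> _ [g sg <-]; rewrite Ad3_triple // Ad_cline //.
  by apply: fl_invK => //; exact: Ad_cstruct.
- by move=> v; apply: fl_chartK.
Qed.

End FlagSubmanifold.

(** * The chart of the quadric of isotropic lines *)

Section Planes.
Variables (R : realType) (m : nat).
Implicit Types (a b v : 'cV[R]_m).

(** Twice the rotation by a right angle in the oriented plane of a
   conformal frame (a, b). *)
Definition plane a b : 'M[R]_m :=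
  (2 / dot a a) *: (b *m a^T - a *m b^T).

Definition conformal a b := dot a a = dot b b /\ dot a b = 0.

Lemma plane_cscale a b x y : conformal a b -> x * x + y * y != 0 ->
  plane (x *: a + y *: b) (- y *: a + x *: b) = plane a b.
Proof.
move=> [ab a0] xy; rewrite /plane.
have -> : dot (x *: a + y *: b) (x *: a + y *: b) = (x * x + y * y) * dot a a.
  by rewrite !dotL (dotC b a) a0 -ab; ring.
have -> : (- y *: a + x *: b) *m (x *: a + y *: b)^T -
    (x *: a + y *: b) *m (- y *: a + x *: b)^T =
    (x * x + y * y) *: (b *m a^T - a *m b^T).
  rewrite !linearD /= !linearZ /= !(mulmxDl, mulmxDr) -!(scalemxAl, scalemxAr).
  by apply/matrixP => i j; rewrite !mxE; ring.
by rewrite scalerA invfM mulrAC -mulrA mulVKf.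
Qed.

Lemma plane_scale a b c : conformal a b -> c != 0 ->
  plane (c *: a) (c *: b) = plane a b.
Proof.
move=> ab c0; have := @plane_cscale a b c 0 ab.
by rewrite oppr0 !scale0r addr0 add0r mulr0 addr0; apply; rewrite mulf_neq0.
Qed.

Lemma Ad_plane g a b : SO g -> Ad g (plane a b) = plane (g *m a) (g *m b).
Proof.
move=> sg; have og := SO_orth sg.
by rewrite AdZ // AdD // AdN // !AdE // /plane orth_dot // !trmx_mul !mulmxA.
Qed.

Lemma planeE a b v : 2^-1 *: plane a b *m v =
  (dot a v / dot a a) *: b - (dot b v / dot a a) *: a.
Proof.
rewrite -!scalemxAl scalerA mulrA mulVf ?pnatr_eq0 // mul1r mulmxBl.
by rewrite !rank1_mul scalerBr !scalerA ![_^-1 * _]mulrC.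
Qed.

Lemma plane_sqrE a b v : conformal a b -> dot a a != 0 ->
  - (2^-1 *: plane a b *m (2^-1 *: plane a b *m v)) =
  (dot a v / dot a a) *: a + (dot b v / dot a a) *: b.
Proof.
move=> [ab ab0] a0; rewrite !planeE !dotL (dotC b a) -ab ab0.
move: (dot a a) a0 (dot a v) (dot b v) => r r0 x y.
by apply/matrixP => i j; rewrite !mxE; field.
Qed.

Lemma frame2 a b : (row_mx a b)^T *m row_mx a b = 1%:M <->
  [/\ dot a a = 1, dot b b = 1 & dot a b = 0].
Proof.
split=> [/frame_cons[aa ba bb]|[aa bb ab]].
  split=> //; last by rewrite dotC; apply/dotE11.
  by rewrite /dot bb mxE eqxx.
apply/frame_cons; split=> //; first by rewrite dotE dotC ab raddf0.
by rewrite dotE bb.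
Qed.

End Planes.

Section ChartPlanes.
Variables (R : realType) (m k : nat).
Variables (a0 b0 : 'cV[R]_m) (N : 'M[R]_(m, k)).
Hypotheses (k2 : (2 < m)%N) (aa0 : dot a0 a0 = 1) (bb0 : dot b0 b0 = 1)
  (ab0 : dot a0 b0 = 0) (NN : N^T *m N = 1%:M) (Na : N^T *m a0 = 0)
  (Nb : N^T *m b0 = 0) (NC : a0 *m a0^T + b0 *m b0^T + N *m N^T = 1%:M).

(** The vectors [pl_a] and [pl_b] are the real and imaginary parts of
   u0 + sigma - k u0^*, where u0 = a0 + i b0 and sigma = s + i t is orthogonal
   to u0 and u0^*; this vector is isotropic for k = sigma^t sigma / 4, whose real
   and imaginary parts are [pl_k1] and [pl_k2]. Conversely the vector A + iB with
   A = [pl_A q] and B = [pl_B q] is twice the projection of u0 to the isotropic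
   line of q. Its hermitian product with u0 is the real number 4 h, where
   h = [pl_h q]; dividing it by 2 h gives the generator whose hermitian product
   with u0 is 2, as for u0 itself. *)
Definition pl_s (v : 'rV[R]_(k + k)) : 'cV[R]_m := N *m (lsubmx v)^T.
Definition pl_t (v : 'rV[R]_(k + k)) : 'cV[R]_m := N *m (rsubmx v)^T.
Definition pl_k1 (s t : 'cV[R]_m) : R := (dot s s - dot t t) / 4.
Definition pl_k2 (s t : 'cV[R]_m) : R := dot s t / 2.
Definition pl_a (s t : 'cV[R]_m) :=
  (1 - pl_k1 s t) *: a0 - pl_k2 s t *: b0 + s.
Definition pl_b (s t : 'cV[R]_m) :=
  - pl_k2 s t *: a0 + (1 + pl_k1 s t) *: b0 + t.
Definition pl_chart v := plane (pl_a (pl_s v) (pl_t v)) (pl_b (pl_s v) (pl_t v)).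

Definition pl_A (q : 'M[R]_m) : 'cV[R]_m :=
  let j := 2^-1 *: q in - (j *m (j *m a0)) - j *m b0.
Definition pl_B (q : 'M[R]_m) : 'cV[R]_m :=
  let j := 2^-1 *: q in - (j *m (j *m b0)) + j *m a0.
Definition pl_h q := (dot a0 (pl_A q) + dot b0 (pl_B q)) / 4.
Definition pl_inv q : 'rV[R]_(k + k) :=
  row_mx (N^T *m ((2 * pl_h q)^-1 *: pl_A q))^T
         (N^T *m ((2 * pl_h q)^-1 *: pl_B q))^T.

Let aN u : dot a0 (N *m u) = 0.
Proof. by rewrite dotC /dot trmx_mul -mulmxA Na mulmx0 mxE. Qed.
Let bN u : dot b0 (N *m u) = 0.
Proof. by rewrite dotC /dot trmx_mul -mulmxA Nb mulmx0 mxE. Qed.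

Section FromChart.
Variables s t : 'cV[R]_m.
Hypotheses (as_ : dot a0 s = 0) (at_ : dot a0 t = 0) (bs : dot b0 s = 0)
  (bt : dot b0 t = 0).
Let a := pl_a s t.
Let b := pl_b s t.
Let sa : dot s a0 = 0. Proof. by rewrite dotC. Qed.
Let sb : dot s b0 = 0. Proof. by rewrite dotC. Qed.
Let ta : dot t a0 = 0. Proof. by rewrite dotC. Qed.
Let tb : dot t b0 = 0. Proof. by rewrite dotC. Qed.
Let ba0 : dot b0 a0 = 0. Proof. by rewrite dotC. Qed.

Definition dots := (aa0, bb0, ab0, ba0, as_, at_, bs, bt, sa, sb, ta, tb).

Lemma pl_conformal : conformal a b.
Proof.
split; rewrite /a /b /pl_a /pl_b; rewrite !dotL !dots.
  by rewrite /pl_k1 /pl_k2; field.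
by rewrite /pl_k1 /pl_k2; field.
Qed.

Lemma pl_a_neq0 : 0 < dot a a.
Proof.
have : 0 < dot a a + dot b b.
  rewrite /a /b /pl_a /pl_b !dotL !dots.
  have := dot_ge0 s; have := dot_ge0 t.
  have := sqr_ge0 (pl_k1 s t); have := sqr_ge0 (pl_k2 s t).
  by rewrite !expr2; lra.
have [-> _] := pl_conformal; lra.
Qed.

Lemma pl_dots :
  [/\ dot a a0 = 1 - pl_k1 s t, dot b a0 = - pl_k2 s t,
      dot a b0 = - pl_k2 s t & dot b b0 = 1 + pl_k1 s t].
Proof. by rewrite /a /b /pl_a /pl_b !dotL !dots; split; ring. Qed.

Lemma pl_AE : pl_A (plane a b) = (2 / dot a a) *: a.
Proof.
have cab := pl_conformal; have r0 := pl_a_neq0; have [aa ba ab bb] := pl_dots.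
rewrite /pl_A /= plane_sqrE ?gt_eqF // planeE aa ba ab bb.
move: (dot a a) r0 => r r0; move: a b => x y.
by apply/matrixP => i j; rewrite !mxE; field; rewrite gt_eqF.
Qed.

Lemma pl_BE : pl_B (plane a b) = (2 / dot a a) *: b.
Proof.
have cab := pl_conformal; have r0 := pl_a_neq0; have [aa ba ab bb] := pl_dots.
rewrite /pl_B /= plane_sqrE ?gt_eqF // planeE aa ba ab bb.
move: (dot a a) r0 => r r0; move: a b => x y.
by apply/matrixP => i j; rewrite !mxE; field; rewrite gt_eqF.
Qed.

Lemma pl_hE : pl_h (plane a b) = (dot a a)^-1.
Proof.
rewrite /pl_h pl_AE pl_BE !dotZr.
have [aE _ _ bE] := pl_dots; rewrite dotC aE dotC bE.
by field; rewrite gt_eqF // pl_a_neq0.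
Qed.

End FromChart.

Lemma pl_chartK v : pl_inv (pl_chart v) = v.
Proof.
have H := pl_a_neq0 (aN (lsubmx v)^T) (aN (rsubmx v)^T)
  (bN (lsubmx v)^T) (bN (rsubmx v)^T).
rewrite /pl_inv /pl_chart pl_hE ?pl_AE ?pl_BE // /pl_s /pl_t ?aN ?bN //.
rewrite !scalerA.
set s := N *m (lsubmx v)^T in H *; set t := N *m (rsubmx v)^T in H *.
have -> : (2 * (dot (pl_a s t) (pl_a s t))^-1)^-1 *
    (2 / dot (pl_a s t) (pl_a s t)) = 1 by field; rewrite gt_eqF.
rewrite !scale1r /pl_a /pl_b !mulmxDr mulmxN -!scalemxAr Na Nb !scaler0.
rewrite subr0 !add0r.
by rewrite /s /t !mulmxA NN !mul1mx !trmxK hsubmxK.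
Qed.

Lemma pl_chart_orbit v : adjoint_orbit (plane a0 b0) (pl_chart v).
Proof.
have [ab ab'] := pl_conformal (aN (lsubmx v)^T) (aN (rsubmx v)^T)
  (bN (lsubmx v)^T) (bN (rsubmx v)^T).
have := pl_a_neq0 (aN (lsubmx v)^T) (aN (rsubmx v)^T)
  (bN (lsubmx v)^T) (bN (rsubmx v)^T).
rewrite /pl_chart /pl_s /pl_t.
move: (pl_a _ _) (pl_b _ _) ab ab' => a b ab ab' a_gt0.
have aN0 : a != 0 by rewrite -dot_eq0 gt_eqF.
have [c c0 cc] := exists_unit aN0.
have [||g sg gE] := @frame_SO_transitive R m (1 + 1)
  (row_mx a0 b0) (row_mx (c *: a) (c *: b)) k2.
- by apply/frame2.
- apply/frame2; split=> //; last by rewrite !dotL ab' !mulr0.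
  by rewrite -cc !dotL ab.
exists g => //.
move: gE; rewrite mul_mx_row => /eq_row_mx[ga gb].
by rewrite Ad_plane // ga gb plane_scale // gt_eqF.
Qed.

(** A conformal pair (a, b) of this form spans an isotropic line, and the two
   conditions of conformality determine p and r. *)
Lemma pl_decomp a b s t p r : conformal a b ->
  dot a0 s = 0 -> dot a0 t = 0 -> dot b0 s = 0 -> dot b0 t = 0 ->
  a = p *: a0 + r *: b0 + s -> b = r *: a0 + (2 - p) *: b0 + t ->
  pl_a s t = a /\ pl_b s t = b.
Proof.
move=> + as_ at_ bs bt aE bE.
rewrite {1}aE {1}bE => -[].
rewrite !dotL !(dots as_ at_ bs bt) => e1 e2.
have k1E : pl_k1 s t = 1 - p.
  have : dot s s - dot t t = 4 * (1 - p) by lra.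
  by rewrite /pl_k1 => ->; field.
have k2E : pl_k2 s t = - r.
  have : dot s t = - 2 * r by lra.
  by rewrite /pl_k2 => ->; field.
rewrite /pl_a /pl_b k1E k2E aE bE; split;
  by apply/matrixP => i j; rewrite !mxE; ring.
Qed.

Section ToChart.
Variables a1 b1 : 'cV[R]_m.
Hypotheses (aa1 : dot a1 a1 = 1) (bb1 : dot b1 b1 = 1) (ab1 : dot a1 b1 = 0).
Let q := plane a1 b1.
Let x := dot a1 a0 + dot b1 b0.
Let y := dot b1 a0 - dot a1 b0.

Let AE : pl_A q = x *: a1 + y *: b1.
Proof.
rewrite /pl_A /= plane_sqrE ?planeE ?aa1 ?oner_neq0 // ?divr1; last first.
  by split; rewrite ?aa1 ?bb1.
by rewrite /x /y; apply/matrixP => i j; rewrite !mxE; ring.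
Qed.

Let BE : pl_B q = - y *: a1 + x *: b1.
Proof.
rewrite /pl_B /= plane_sqrE ?planeE ?aa1 ?oner_neq0 // ?divr1; last first.
  by split; rewrite ?aa1 ?bb1.
by rewrite /x /y; apply/matrixP => i j; rewrite !mxE; ring.
Qed.

Let hE : pl_h q = (x * x + y * y) / 4.
Proof.
rewrite /pl_h AE BE !dotL [dot a0 a1]dotC [dot a0 b1]dotC [dot b0 a1]dotC
  [dot b0 b1]dotC; congr (_ / _).
by rewrite /x /y; ring.
Qed.

Lemma pl_invK : pl_h q != 0 -> pl_chart (pl_inv q) = q.
Proof.
move=> h0; pose c := (2 * pl_h q)^-1.
have xy : x * x + y * y != 0 by apply: contra h0; rewrite hE => /eqP->; rewrite mul0r.
pose a := c *: pl_A q; pose b := c *: pl_B q.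
have cfAB : conformal (pl_A q) (pl_B q).
  by split; rewrite AE BE !dotL aa1 bb1 (dotC b1) ab1; ring.
have cab : conformal a b.
  case: cfAB => e1 e2; rewrite /a /b; split.
    by rewrite !(dotZl, dotZr) e1.
  by rewrite !(dotZl, dotZr) e2 !mulr0.
have c4 : c = 2 / (x * x + y * y) by rewrite /c hE; field.
have tr : dot a0 a + dot b0 b = 2.
  rewrite /a /b AE BE !dotL [dot a0 a1]dotC [dot a0 b1]dotC [dot b0 a1]dotC
  [dot b0 b1]dotC c4; move: xy; rewrite /x /y => xy; field.
  exact: xy.
have sy : dot a0 b = dot b0 a.
  rewrite /a /b AE BE !dotL [dot a0 a1]dotC [dot a0 b1]dotC [dot b0 a1]dotC
  [dot b0 b1]dotC; rewrite /x /y; ring.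
have dec u : dot a0 u *: a0 + dot b0 u *: b0 + N *m (N^T *m u) = u.
  by rewrite -[RHS]mul1mx -NC !mulmxDl !rank1_mul mulmxA.
rewrite /pl_chart /pl_s /pl_t row_mxKl row_mxKr !trmxK -/c -/a -/b.
set s := N *m (N^T *m a); set t := N *m (N^T *m b).
have da := dec a; have db := dec b; rewrite -/s -/t in da db.
have [sa ta sb tb] : [/\ dot a0 s = 0, dot a0 t = 0, dot b0 s = 0 & dot b0 t = 0].
  by split; [exact: aN|exact: aN|exact: bN|exact: bN].
pose p := dot a0 a; pose r := dot b0 a.
have p2 : dot b0 b = 2 - p by rewrite -tr /p; ring.
have da' : a = p *: a0 + r *: b0 + s by rewrite -da.
have db' : b = r *: a0 + (2 - p) *: b0 + t by rewrite -{1}db sy p2.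
have [-> ->] := pl_decomp cab sa ta sb tb da' db'.
rewrite /a /b plane_scale //; last by rewrite invr_eq0 mulf_neq0 ?pnatr_eq0.
by rewrite AE BE plane_cscale // /conformal aa1 bb1.
Qed.

End ToChart.

Lemma pl_h_base : pl_h (plane a0 b0) != 0.
Proof.
have x0 : dot a0 (0 : 'cV[R]_m) = 0 by rewrite dot0r.
have y0 : dot b0 (0 : 'cV[R]_m) = 0 by rewrite dot0r.
have := pl_hE x0 x0 y0 y0; have := pl_a_neq0 x0 x0 y0 y0.
rewrite /pl_a /pl_b /pl_k1 /pl_k2 dot0r subrr !mul0r subr0 addr0 !oppr0.
rewrite !scale0r !addr0 !scale1r add0r subr0 => p0 ->.
by rewrite invr_eq0 gt_eqF.
Qed.

Lemma smooth_plane (W : normedModType R) (U : set W) (f g : W -> 'cV[R]_m) :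
  open U -> (forall x, U x -> dot (f x) (f x) != 0) ->
  smooth_on U f -> smooth_on U g -> smooth_on U (fun x => plane (f x) (g x)).
Proof.
move=> oU f0 sf sg; apply: smooth_scale => //.
  apply: smooth_mul => //; first exact: smooth_cst.
  by apply: smooth_inv => //; apply: smooth_dot.
apply: smooth_sub => //; apply: smooth_mulmx => //; exact: smooth_trmx.
Qed.

Lemma smooth_pl_chart : smooth_on setT pl_chart.
Proof.
have oT := @openT 'rV[R]_(k + k).
have sid := smooth_id oT.
have ss : smooth_on setT pl_s.
  apply: smooth_mulmx => //; first exact: smooth_cst.
  apply: smooth_trmx => //; apply: (smooth_linear oT (f := lsubmx) _ sid).
  by move=> c x y; rewrite linearP.
have st : smooth_on setT pl_t.
  apply: smooth_mulmx => //; first exact: smooth_cst.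
  apply: smooth_trmx => //; apply: (smooth_linear oT (f := rsubmx) _ sid).
  by move=> c x y; rewrite linearP.
have s1 : smooth_on setT (fun v => pl_k1 (pl_s v) (pl_t v)).
  apply: smooth_mul => //; last exact: smooth_cst.
  apply: (smooth_ext oT (f := fun v =>
    dot (pl_s v) (pl_s v) + -1 * dot (pl_t v) (pl_t v))).
    by move=> v _; rewrite mulN1r.
  apply: smooth_add => //; first exact: smooth_dot.
  by apply: smooth_mul => //; [exact: smooth_cst|exact: smooth_dot].
have s2 : smooth_on setT (fun v => pl_k2 (pl_s v) (pl_t v)).
  by apply: smooth_mul => //; [exact: smooth_dot|exact: smooth_cst].
have sN (f : 'rV[R]_(k + k) -> R) :
    smooth_on setT f -> smooth_on setT (fun v => - f v).
  move=> sf; apply: (smooth_ext oT (f := fun v => -1 * f v)).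
    by move=> v _; rewrite mulN1r.
  by apply: smooth_mul => //; apply: smooth_cst.
have sc (f : 'rV[R]_(k + k) -> R) (u : 'cV[R]_m) :
    smooth_on setT f -> smooth_on setT (fun v => f v *: u).
  by move=> sf; apply: smooth_scale => //; apply: smooth_cst.
have s1' : smooth_on setT (fun v => 1 - pl_k1 (pl_s v) (pl_t v)).
  by apply: smooth_add => //; [exact: smooth_cst|exact: sN].
have s1'' : smooth_on setT (fun v => 1 + pl_k1 (pl_s v) (pl_t v)).
  by apply: smooth_add => //; exact: smooth_cst.
apply: smooth_plane => //.
- move=> v _; rewrite gt_eqF //.
  by apply: pl_a_neq0; [exact: aN|exact: aN|exact: bN|exact: bN].
- apply: smooth_add => //; apply: smooth_sub => //; exact: sc.
- apply: smooth_add => //; apply: smooth_add => //; apply: sc => //; exact: sN.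
Qed.

Section SmoothInverse.
Variable U : set 'M[R]_m.
Hypothesis oU : open U.
Let sid := smooth_id oU.
Let sc (u : 'cV[R]_m) : smooth_on U (fun q => 2^-1 *: q *m u).
Proof.
apply: smooth_mulmx => //; last exact: smooth_cst.
by apply: smooth_scale => //; exact: smooth_cst.
Qed.
Let scc (u : 'cV[R]_m) : smooth_on U (fun q => 2^-1 *: q *m (2^-1 *: q *m u)).
Proof.
apply: smooth_mulmx => //.
by apply: smooth_scale => //; exact: smooth_cst.
Qed.

Let smooth_pl_A : smooth_on U pl_A.
Proof. by apply: smooth_sub => //; apply: smooth_opp. Qed.
Let smooth_pl_B : smooth_on U pl_B.
Proof. by apply: smooth_add => //; apply: smooth_opp. Qed.

Lemma smooth_pl_h : smooth_on U pl_h.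
Proof.
apply: smooth_mul => //; last exact: smooth_cst.
by apply: smooth_add => //; apply: smooth_dot => //; apply: smooth_cst.
Qed.

Lemma smooth_pl_inv : (forall q, U q -> pl_h q != 0) -> smooth_on U pl_inv.
Proof.
move=> h0.
have si : smooth_on U (fun q => (2 * pl_h q)^-1).
  apply: smooth_inv => //; first by move=> q /h0 ?; rewrite mulf_neq0 ?pnatr_eq0.
  by apply: smooth_mul => //; [exact: smooth_cst|exact: smooth_pl_h].
apply: smooth_row_mx => //; apply: smooth_trmx => //; apply: smooth_mulmx => //;
  first [exact: smooth_cst | exact: smooth_scale].
Qed.

End SmoothInverse.
End ChartPlanes.

Lemma submanifold_plane (R : realType) (m k : nat) (a b : 'cV[R]_m) :
  m = (2 + k)%N -> (0 < k)%N -> dot a a = 1 -> dot b b = 1 -> dot a b = 0 ->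
  submanifold (k + k) (adjoint_orbit (plane a b)).
Proof.
move=> mE k0 aa bb ab; apply: chart_submanifold => _ [g0 sg0 <-].
have og := SO_orth sg0.
have pE : Ad g0 (plane a b) = plane (g0 *m a) (g0 *m b) by rewrite Ad_plane.
rewrite pE.
have aa1 : dot (g0 *m a) (g0 *m a) = 1 by rewrite orth_dot.
have bb1 : dot (g0 *m b) (g0 *m b) = 1 by rewrite orth_dot.
have ab1 : dot (g0 *m a) (g0 *m b) = 0 by rewrite orth_dot.
have orbE : adjoint_orbit (plane a b) (plane (g0 *m a) (g0 *m b)) by exists g0.
move: (g0 *m a) (g0 *m b) aa1 bb1 ab1 orbE => a1 b1 aa1 bb1 ab1 orbE.
have [N [NN Na Nb NC]] : exists N : 'M[R]_(m, k),
    [/\ N^T *m N = 1%:M, N^T *m a1 = 0, N^T *m b1 = 0 &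
     a1 *m a1^T + b1 *m b1^T + N *m N^T = 1%:M].
  have AA : (row_mx a1 b1)^T *m row_mx a1 b1 = 1%:M by apply/frame2.
  clear -mE AA; move: a1 b1 AA; subst m => a1 b1 AA.
  have [N [NN NA AN]] := frame_complement (k := 1 + 1) AA.
  exists N; split => //.
  - by move: NA; rewrite mul_mx_row => /eqP; rewrite row_mx_eq0 => /andP[/eqP].
  - by move: NA; rewrite mul_mx_row => /eqP; rewrite row_mx_eq0 => /andP[_ /eqP].
  by rewrite -AN tr_row_mx mul_row_col.
have m2 : (2 < m)%N by rewrite mE; lia.
exists (pl_h a1 b1), (pl_chart a1 b1 N), (pl_inv a1 b1 N).
have sh := smooth_pl_h a1 b1 openT.
have oU := open_neq0 sh.
split; split=> //.
- exact: pl_h_base.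
- exact: smooth_pl_chart.
- exact: smooth_pl_inv.
- by move=> v; apply: orbit_trans orbE _; exact: pl_chart_orbit.
- move=> _ [g sg <-]; rewrite Ad_plane //; have og' := SO_orth sg.
  by apply: pl_invK => //; rewrite orth_dot.
- by move=> v _; exact: pl_chartK.
Qed.

(** * Tangent vectors and the symplectic form *)

Section Lie.
Variables (R : realType) (m : nat).
Implicit Types (x y a b : 'M[R]_m).

Lemma lieDl x y a : lie (x + y) a = lie x a + lie y a.
Proof. by rewrite /lie mulmxDl mulmxDr opprD addrACA. Qed.
Lemma lieDr x a b : lie x (a + b) = lie x a + lie x b.
Proof. by rewrite /lie mulmxDl mulmxDr opprD addrACA. Qed.
Lemma lieNr x a : lie x (- a) = - lie x a.
Proof. by rewrite /lie mulmxN mulNmx opprB opprK addrC. Qed.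
Lemma lieZr x c a : lie x (c *: a) = c *: lie x a.
Proof. by rewrite /lie -scalemxAr -scalemxAl scalerBr. Qed.
Lemma lie_mul x a b : lie x (a *m b) = lie x a *m b + a *m lie x b.
Proof.
by rewrite /lie mulmxBl mulmxBr !mulmxA addrA subrK.
Qed.
Lemma lie1 x : lie x 1%:M = 0.
Proof. by rewrite /lie mulmx1 mul1mx subrr. Qed.
Lemma lie_skew x a : so x -> a^T = - a -> (lie x a)^T = - lie x a.
Proof.
rewrite /so /= => xt at_; rewrite /lie linearB /= !trmx_mul xt at_.
by rewrite !mulmxN !mulNmx !opprK opprB.
Qed.

Definition proj_pair (J Q : 'M[R]_m) :=
  [/\ cstruct J, Q^T = Q, Q *m Q = Q & J *m Q = Q *m J].

(** Any first-order variation (j, q) of a pair (J, Q) is generated by a skew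
   matrix. The commutator [q, Q] moves Q by q; the remaining variation H of J
   anticommutes with J and commutes with Q, and is generated by JH / 2, which
   fixes Q. *)
Lemma infinitesimal_generator J Q (j q : 'M[R]_m) : proj_pair J Q ->
  j^T = - j -> j *m J + J *m j = 0 -> q^T = q -> q *m Q + Q *m q = q ->
  j *m Q + J *m q = q *m J + Q *m j ->
  exists xi, [/\ so xi, lie xi J = j & lie xi Q = q].
Proof.
move=> [[Jt JJ] Qt QQ JQ] jt jJ qt qQ jQ.
have QqQ : Q *m q *m Q = 0.
  have := congr1 (fun M => Q *m M) qQ.
  by rewrite mulmxDr !mulmxA QQ => /eqP; rewrite -subr_eq0 addrK => /eqP.
have [x1 x1t x1Q] : exists2 x1, so x1 & lie x1 Q = q.
  exists (q *m Q - Q *m q).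
    by rewrite /so /= linearB /= !trmx_mul Qt qt opprB.
  rewrite /lie mulmxBl mulmxBr !mulmxA QqQ QQ -[q *m Q *m Q]mulmxA QQ.
  by rewrite subr0 sub0r opprK.
have D1 : lie x1 J *m J + J *m lie x1 J = 0.
  by rewrite -lie_mul JJ lieNr lie1 oppr0.
have D2 : lie x1 J *m Q + J *m q = q *m J + Q *m lie x1 J.
  by rewrite -{1}x1Q -lie_mul JQ lie_mul x1Q.
pose H := j - lie x1 J.
have Ht : H^T = - H by rewrite linearB /= jt lie_skew // opprK opprB addrC.
have HJ : H *m J = - (J *m H).
  apply/eqP; rewrite -addr_eq0 mulmxBl mulmxBr addrACA jJ -opprD D1 oppr0.
  by rewrite addr0.
have HQ : H *m Q = Q *m H.
  have swap (a b c d : 'M[R]_m) : a + b = c + d -> a - d = c - b.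
    by move=> E; rewrite -[a](addrK b) E addrAC addrK.
  apply/eqP; rewrite -subr_eq0 mulmxBl mulmxBr opprB [X in _ + X]addrC addrACA.
  rewrite (swap _ _ _ _ jQ) [X in _ + X]addrC -[X in _ + X]opprB.
  by rewrite (swap _ _ _ _ D2) subrr.
exists (x1 + 2^-1 *: (J *m H)); split.
- rewrite /so /= linearD linearZ /= trmx_mul Ht Jt mulmxN mulNmx opprK HJ.
  by rewrite scalerN x1t opprD.
- rewrite lieDl /lie -scalemxAl -scalemxAr -scalerBr -[J *m H *m J]mulmxA HJ.
  rewrite mulmxN !mulmxA JJ mulNmx mul1mx opprK -mulr2n -[H *+ 2]scaler_nat scalerA.
  by rewrite mulVf ?pnatr_eq0 // scale1r -/(lie x1 J) /H addrC subrK.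
- rewrite lieDl x1Q /lie -scalemxAl -scalemxAr -scalerBr -mulmxA HQ.
  by rewrite !mulmxA JQ subrr scaler0 addr0.
Qed.

Lemma proj_pair_cstruct J Q : proj_pair J Q -> cstruct (2 *: (J *m Q) - J).
Proof.
move=> [[Jt JJ] Qt QQ JQ]; split.
  rewrite linearB linearZ /= trmx_mul Qt Jt mulmxN -JQ scalerN.
  by rewrite opprK opprB addrC.
have JJQ : J *m (J *m Q) = - Q by rewrite mulmxA JJ mulNmx mul1mx.
have JQJ : J *m Q *m J = - Q by rewrite JQ -mulmxA JJ mulmxN mulmx1.
have JQJQ : J *m Q *m (J *m Q) = - Q by rewrite mulmxA JQJ mulNmx QQ.
rewrite mulmxBl !mulmxBr -!scalemxAl -!scalemxAr JQJQ JQJ JJQ JJ.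
by apply/matrixP => i j; rewrite !mxE; ring.
Qed.

Lemma cline_proj J (w : 'cV[R]_m) : cstruct J -> dot w w = 1 ->
  proj_pair J (cline J w).
Proof.
move=> cJ ww; have [Jt JJ] := cJ; rewrite /cline ww invr1 scale1r.
have Jtr : (J *m w)^T = - (w^T *m J) by rewrite trmx_mul Jt mulmxN.
have wJw : w^T *m J *m w = 0 by rewrite -mulmxA; apply/dotE11; exact: skew_dot.
split=> //.
- by rewrite linearD /= !trmx_mul !trmxK.
- have rk (a b c d : 'cV[R]_m) :
      a *m b^T *m (c *m d^T) = dot b c *: (a *m d^T).
    by rewrite mulmxA rank1_mul -scalemxAl.
  have wu : dot w (J *m w) = 0 by exact: skew_dot.
  rewrite mulmxDl !mulmxDr !rk (dotC (J *m w) w) wu cstruct_dot // ww.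
  by rewrite !scale1r !scale0r add0r addr0.
- rewrite Jtr !(mulmxDr, mulmxDl) !mulmxN !mulNmx !mulmxA.
  by rewrite JJ -[J *m w *m w^T *m J *m J]mulmxA JJ !mulNmx !mulmxN mul1mx mulmx1 !opprK addrC.
Qed.

Lemma Ad_proj_pair g J Q : SO g -> proj_pair J Q -> proj_pair (Ad g J) (Ad g Q).
Proof.
move=> sg [cJ Qt QQ JQ]; split; first exact: Ad_cstruct.
- by rewrite AdT // Qt.
- by rewrite -AdM // QQ.
- by rewrite -!AdM // JQ.
Qed.

Definition flag_orbit J Q := [set Ad3 g (triple J Q) | g in @SO R m].

Definition lie3 x (p : 'M[R]_m * 'M[R]_m * 'M[R]_m) :=
  (lie x p.1.1, lie x p.1.2, lie x p.2).

(** The pair (J, Q) depends polynomially on the point, by Q = J p3 / 2, so that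
   a differentiable curve in the orbit gives a variation of (J, Q). *)
Lemma flag_tangent J Q p u : proj_pair J Q ->
  flag_orbit J Q p -> tangent (flag_orbit J Q) p u ->
  exists2 x, so x & u = lie3 x p.
Proof.
move=> JQ0 Lp [c [c0 Lc dc]].
have [/is_derive_pair[/= d1 d2] d3] := is_derive_pair dc.
pose Jt t := (c t).1.1; pose Qt t := 2^-1 *: (Jt t *m (c t).2).
have cE t : proj_pair (Jt t) (Qt t) /\ c t = triple (Jt t) (Qt t).
  have [g sg gE] := Lc t; rewrite Ad3_triple // in gE.
  have pp := Ad_proj_pair sg JQ0.
  have JE : Jt t = Ad g J by rewrite /Jt -gE.
  have QE : Qt t = Ad g Q.
    rewrite /Qt JE -gE /= -scalemxAr mulmxA scalerA.
    have [[_ ->] _ _ _] := pp.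
    by rewrite mulNmx mul1mx scalerN -scaleNr mulrN opprK mulVf ?pnatr_eq0 // scale1r.
  by rewrite JE QE.
set u1 := u.1.1 in d1; set u3 := u.2 in d3.
pose q := 2^-1 *: (u1 *m (c 0).2 + Jt 0 *m u3).
have dJ : is_derive 0 (1 : R) Jt u1 by [].
have dQ : is_derive 0 (1 : R) Qt q.
  by apply: is_deriveZ; apply: is_derive_mulmx.
have dJQ := is_derive_mulmx dJ dQ.
have eqd (f g : R -> 'M[R]_m) a b : (forall t, f t = g t) ->
    is_derive 0 (1 : R) f a -> is_derive 0 (1 : R) g b -> a = b.
  by move=> fg; rewrite (funext fg); apply: is_derive_unique.
have [pp0 c0E] := cE 0.
have e1 : u1^T = - u1.
  apply: (eqd _ (fun t => - Jt t)) (is_derive_trmx dJ) (is_deriveN _).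
  by move=> t; have [[[-> _] _ _ _] _] := cE t.
have e2 : u1 *m Jt 0 + Jt 0 *m u1 = 0.
  apply: (eqd _ (cst (- 1%:M))) (is_derive_mulmx dJ dJ) (is_derive_cst _ _ _).
  by move=> t; have [[[_ ->] _ _ _] _] := cE t.
have e3 : q^T = q.
  apply: (eqd _ Qt) (is_derive_trmx dQ) dQ.
  by move=> t; have [[_ -> _ _] _] := cE t.
have e4 : q *m Qt 0 + Qt 0 *m q = q.
  apply: (eqd _ Qt) (is_derive_mulmx dQ dQ) dQ.
  by move=> t; have [[_ _ -> _] _] := cE t.
have e5 : u1 *m Qt 0 + Jt 0 *m q = q *m Jt 0 + Qt 0 *m u1.
  apply: (eqd _ _) dJQ (is_derive_mulmx dQ dJ).
  by move=> t; have [[_ _ _ ->] _] := cE t.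
have e6 : u.1.2 = 2 *: (u1 *m Qt 0 + Jt 0 *m q) - u1.
  apply: (eqd _ _ _ _ _ d2 (is_deriveB (is_deriveZ 2 dJQ) dJ)) => t.
  by have [_ {1}->] := cE t.
have e7 : u3 = (- 2) *: (u1 *m Qt 0 + Jt 0 *m q).
  apply: (eqd _ _ _ _ _ d3 (is_deriveZ (- 2) dJQ)) => t.
  by have [_ {1}->] := cE t.
have [x [sx xJ xQ]] := infinitesimal_generator pp0 e1 e2 e3 e4 e5.
exists x => //; rewrite -c0 c0E /lie3 /=.
rewrite lieDr lieNr !lieZr lie_mul xJ xQ -e6 -e7.
by rewrite /u1 /u3; case: (u) => [[]].
Qed.

(** The three components of a point of the orbit add up to zero. *)
Lemma flag_kks J Q p u v : proj_pair J Q -> flag_orbit J Q p ->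
  tangent (flag_orbit J Q) p u -> tangent (flag_orbit J Q) p v ->
  kks3 p u v = 0.
Proof.
move=> JQ Lp /(flag_tangent JQ Lp)[x sx ->] /(flag_tangent JQ Lp)[y sy ->].
rewrite /kks3 /lie3 /= !kks_lie //.
rewrite -!linearD /= -!mulmxDl.
have [g sg <-] := Lp; rewrite Ad3_triple //= addrC.
move: (Ad g J *m Ad g Q) => X.
by rewrite [Ad g J + _]addrC subrK scaleNr addNr mul0mx mxtrace0.
Qed.

End Lie.

(** * Subspaces of the complexification and real matrices *)

Section ComplexVectors.
Variables (R : realType) (m : nat).
Implicit Types (a b c d : 'cV[R]_m) (g J : 'M[R]_m).
Local Notation vec := 'cV[R[i]]_m.
Local Notation conjmx := Pilot.Defs.conjmx.
Implicit Types (z x y : {vspace vec}) (u v : vec).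

Definition cvec a b : vec := \col_k (a k 0 +i* b k 0)%C.
Definition rpart v : 'cV[R]_m := map_mx (@complex.Re R) v.
Definition ipart v : 'cV[R]_m := map_mx (@complex.Im R) v.

Lemma cvecE v : v = cvec (rpart v) (ipart v).
Proof. by apply/colP => k; rewrite !mxE; case: (v k 0). Qed.

Lemma cvec_inj a b c d : cvec a b = cvec c d -> a = c /\ b = d.
Proof.
by move=> /colP E; split; apply/colP => k; have := E k; rewrite !mxE => -[].
Qed.

Lemma cvecD a b c d : cvec a b + cvec c d = cvec (a + c) (b + d).
Proof. by apply/colP => k; rewrite !mxE. Qed.

Lemma cvecZ (s t : R) a b :
  (s +i* t)%C *: cvec a b = cvec (s *: a - t *: b) (t *: a + s *: b).
Proof. by apply/colP => k; rewrite !mxE; simpc; rewrite [t * _ + _]addrC. Qed.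

Lemma cvecN a b : - cvec a b = cvec (- a) (- b).
Proof. by apply/colP => k; rewrite !mxE. Qed.

Lemma cvec0 : cvec 0 0 = 0.
Proof. by apply/colP => k; rewrite !mxE. Qed.

Lemma conj_cvec a b : conjmx (cvec a b) = cvec a (- b).
Proof. by apply/colP => k; rewrite !mxE. Qed.

Lemma mul_cvec J a b : map_mx (real_complex R) J *m cvec a b = cvec (J *m a) (J *m b).
Proof.
apply/colP => k; rewrite !mxE.
have -> : ((\sum_j J k j * a j 0) +i* (\sum_j J k j * b j 0))%C =
    \sum_j ((J k j * a j 0) +i* (J k j * b j 0))%C.
  by elim/big_rec3: _ => // i p q r _ <-; simpc.
by apply: eq_bigr => j _; rewrite !mxE; simpc.
Qed.

Lemma cvec_dot a b c d : ((cvec a b)^T *m cvec c d) 0 0 =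
  ((dot a c - dot b d) +i* (dot a d + dot b c))%C.
Proof.
rewrite mxE !dot_sum -sumrN -!big_split /=.
have -> : ((\sum_i (a i 0 * c i 0 - b i 0 * d i 0)) +i*
     (\sum_i (a i 0 * d i 0 + b i 0 * c i 0)))%C =
    \sum_i ((a i 0 * c i 0 - b i 0 * d i 0) +i* (a i 0 * d i 0 + b i 0 * c i 0))%C.
  by elim/big_rec3: _ => // i p q r _ <-; simpc.
by apply: eq_bigr => j _; rewrite !mxE; simpc.
Qed.

Lemma cvec_bilin0 a b c d : (cvec a b)^T *m cvec c d = 0 <->
  dot a c = dot b d /\ dot a d = - dot b c.
Proof.
split=> [E|[e1 e2]].
  have := cvec_dot a b c d; rewrite E mxE => /eqP.
  by rewrite eq_sym eq_complex /= subr_eq0 addr_eq0 => /andP[/eqP -> /eqP ->].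
rewrite [LHS]mx11_scalar cvec_dot e1 e2 subrr addNr.
by apply/matrixP => i j; rewrite !mxE mul0rn.
Qed.

Lemma cvec_herm0 a b c d : (conjmx (cvec a b))^T *m cvec c d = 0 <->
  dot a c = - dot b d /\ dot a d = dot b c.
Proof.
by rewrite conj_cvec cvec_bilin0 !dotNl opprK.
Qed.

Lemma conjmxK v : conjmx (conjmx v) = v.
Proof. by rewrite [v]cvecE !conj_cvec opprK. Qed.

Lemma act_mem g z v : SO g ->
  (v \in act g z) = (map_mx (real_complex R) g^T *m v \in z).
Proof.
move=> sg; have og := SO_orth sg.
have gg : map_mx (real_complex R) g *m map_mx (real_complex R) g^T = 1%:M.
  by rewrite -map_mxM og map_mx1.
have gg' : map_mx (real_complex R) g^T *m map_mx (real_complex R) g = 1%:M.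
  by rewrite -map_mxM (orthT og) map_mx1.
apply/memv_imgP/idP => [[u uz ->]|vz].
  by rewrite lfunE /= mulmxA gg' mul1mx.
exists (map_mx (real_complex R) g^T *m v) => //.
by rewrite lfunE /= mulmxA gg mul1mx.
Qed.

Lemma act_cvec g z a b : SO g ->
  (cvec a b \in act g z) = (cvec (g^T *m a) (g^T *m b) \in z).
Proof. by move=> sg; rewrite act_mem // mul_cvec. Qed.

Lemma actD g x y : act g (x + y)%VS = (act g x + act g y)%VS.
Proof. by rewrite /act limgD. Qed.

Lemma act_conjv g z : SO g -> act g (conjv z) = conjv (act g z).
Proof.
move=> sg; apply/vspaceP => v.
rewrite memv_conjv [v]cvecE conj_cvec !act_cvec // memv_conjv conj_cvec.
by rewrite mulmxN.
Qed.

Lemma act_line g a b : act g <[cvec a b]>%VS = <[cvec (g *m a) (g *m b)]>%VS.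
Proof. by rewrite /act limg_line lfunE /= mul_cvec. Qed.

(** The equation Jv = iv, written on the real and imaginary parts of v. *)
Definition i_eigenspace J z :=
  forall a b, cvec a b \in z <-> J *m a = - b /\ J *m b = a.

Lemma eig_inj J z z' : i_eigenspace J z -> i_eigenspace J z' -> z = z'.
Proof.
move=> e e'; apply/vspaceP => v; rewrite [v]cvecE.
by apply/idP/idP => [/e/e'|/e'/e].
Qed.

Lemma eig_graph J z a : cstruct J -> i_eigenspace J z -> cvec a (- (J *m a)) \in z.
Proof.
move=> [_ JJ] e; apply/e; split; first by rewrite opprK.
by rewrite mulmxN mulmxA JJ mulNmx mul1mx opprK.
Qed.

Lemma eig_fun J J' z : cstruct J -> i_eigenspace J z -> i_eigenspace J' z -> J = J'.
Proof.
move=> cJ e e'; apply: eq_mulcv => a.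
by have /e'[-> _] := eig_graph a cJ e; rewrite opprK.
Qed.

Lemma eig_act g J z : SO g -> i_eigenspace J z -> i_eigenspace (Ad g J) (act g z).
Proof.
move=> sg e a b; rewrite act_cvec // e AdE //.
have og := SO_orth sg; have og' := orthT og.
have E (u v : 'cV[R]_m) : J *m (g^T *m u) = g^T *m v <-> g *m J *m g^T *m u = v.
  split=> [H|<-]; last by rewrite !mulmxA og' mul1mx.
  by rewrite -!mulmxA H mulmxA og mul1mx.
by rewrite -mulmxN !E.
Qed.

Lemma isotropicP z : isotropic z <->
  (forall a b c d, cvec a b \in z -> cvec c d \in z ->
  dot a c = dot b d /\ dot a d = - dot b c).
Proof.
split=> [iz a b c d abz cdz|H u v]; first exact/cvec_bilin0/iz.
by rewrite [u]cvecE [v]cvecE => uz vz; apply/cvec_bilin0; apply: H.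
Qed.

Lemma cvec_sum I (r : seq I) (F G : I -> 'cV[R]_m) :
  \sum_(i <- r) cvec (F i) (G i) = cvec (\sum_(i <- r) F i) (\sum_(i <- r) G i).
Proof. by elim/big_rec3: _ => [|i p q s _ ->]; rewrite ?cvec0 ?cvecD. Qed.

(** As z and its conjugate are complementary, every real vector a is the real
   part of a vector a + ib in z. By isotropy no nonzero real vector is in z, so that
   b is unique; then J a = - b defines a real linear map, and isotropy of z says
   that it is skew and orthogonal. *)
Lemma isotropic_complex_structure n z : m = (n + n)%N ->
  \dim z = n -> isotropic z -> exists J, cstruct J /\ i_eigenspace J z.
Proof.
move=> mE dz /isotropicP iz.
have realz a : cvec a 0 \in z -> a = 0.
  move=> az; have [] := iz _ _ _ _ az az; rewrite dot0l => /eqP.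
  by rewrite dot_eq0 => /eqP.
have cap0 : (z :&: conjv z)%VS = 0%VS.
  apply/eqP; rewrite -subv0; apply/subvP => v; rewrite memv_cap memv_conjv.
  rewrite [v]cvecE conj_cvec => /andP[v1 v2].
  have [] := iz _ _ _ _ v1 v2; rewrite dotNr => e _.
  have := dot_ge0 (rpart v); have := dot_ge0 (ipart v) => h1 h2.
  have /eqP : dot (rpart v) (rpart v) = 0 by lra.
  have /eqP : dot (ipart v) (ipart v) = 0 by lra.
  by rewrite !dot_eq0 => /eqP -> /eqP ->; rewrite cvec0 mem0v.
have dle (y : {vspace vec}) : (\dim (conjv y) <= \dim y)%N.
  by apply: leq_trans (dim_span _) _; rewrite size_map size_tuple.
have conjvK (y : {vspace vec}) : conjv (conjv y) = y.
  by apply/vspaceP => v; rewrite !memv_conjv conjmxK.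
have dc : \dim (conjv z) = n.
  by apply/eqP; rewrite -dz eqn_leq dle -{1}[z]conjvK dle.
have full : (z + conjv z)%VS = fullv.
  apply/eqP; rewrite eqEdim subvf /= dimvf /dim /= muln1 dimv_disjoint_sum //.
  by rewrite dz dc mE.
have [f fz] : {f : 'cV[R]_m -> 'cV[R]_m & forall a, cvec a (f a) \in z}.
  apply: (@boolp.choice _ _ (fun a b => is_true (cvec a b \in z))) => a.
  have : cvec a 0 \in (z + conjv z)%VS by rewrite full memvf.
  case/memv_addP => v1 z1 [v2]; rewrite memv_conjv => z2.
  rewrite [v1]cvecE [v2]cvecE cvecD => /cvec_inj[aE bE].
  exists (ipart v1 + ipart v1).
  (* As a = v1 + v2 is real, it is also the real part of v1 + v2^*. *)
  have -> : cvec a (ipart v1 + ipart v1) = v1 + conjmx v2.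
    rewrite [v2]cvecE conj_cvec {3}[v1]cvecE cvecD aE; congr (cvec _ (_ + _)).
    by apply/eqP; rewrite -subr_eq0 opprK -bE.
  exact: memvD.
pose J : 'M[R]_m := \matrix_(i, k) - f (delta_mx k 0) i 0.
have graph a : cvec a (- (J *m a)) \in z.
  have -> : cvec a (- (J *m a)) =
      \sum_k (a k 0 +i* 0)%C *: cvec (delta_mx k 0) (f (delta_mx k 0)).
    have E k : (a k 0 +i* 0)%C *: cvec (delta_mx k 0) (f (delta_mx k 0)) =
       cvec (a k 0 *: delta_mx k 0) (a k 0 *: f (delta_mx k 0)).
      by rewrite cvecZ !scale0r subr0 add0r.
    rewrite (eq_bigr _ (fun k _ => E k)) cvec_sum; congr cvec.
      by rewrite {1}[a]matrix_sum_delta; apply: eq_bigr => k _; rewrite big_ord1.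
    apply/colP => k; rewrite !mxE -sumrN summxE; apply: eq_bigr => l _.
    by rewrite !mxE mulNr opprK mulrC.
  by apply: memv_suml => k _; apply: memvZ.
have orthJ a c : dot a c = dot (J *m a) (J *m c) /\ dot a (J *m c) = - dot (J *m a) c.
  have [] := iz _ _ _ _ (graph a) (graph c).
  by rewrite !dotNl !dotNr !opprK => -> e; split=> //; rewrite -[LHS]opprK e.
have dot_ext (u v : 'cV[R]_m) : (forall c, dot c u = dot c v) -> u = v.
  move=> H; apply/eqP; rewrite -subr_eq0 -dot_eq0 dotDr dotNr H.
  by rewrite subrr.
have Jt : J^T = - J.
  apply: eq_mulcv => a; apply: dot_ext => c.
  by rewrite -dot_mull mulNmx dotNr (orthJ c a).2 opprK.
have JJ : J *m J = - 1%:M.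
  apply: eq_mulcv => a; apply: dot_ext => c.
  rewrite -mulmxA mulNmx mul1mx dotNr (orthJ c a).1.
  by rewrite (orthJ c (J *m a)).2.
exists J; split; first by [].
move=> a b; split=> [abz|[E _]]; last by rewrite -[b]opprK -E.
have bE : b = - (J *m a).
  apply/eqP; rewrite -subr_eq0 opprK; apply/eqP; apply: realz.
  (* The difference of the two vectors is imaginary: - i makes it real. *)
  have := memvZ (0 +i* (-1))%C (memvB abz (graph a)).
  rewrite cvecN cvecD cvecZ subrr opprK scaler0 !scale0r sub0r addr0.
  by rewrite scaleN1r opprK scaler0.
split; first by rewrite bE opprK.
by rewrite bE mulmxN mulmxA JJ mulNmx mul1mx opprK.
Qed.

(** Isotropic lines correspond to oriented real planes, and thus to the skew
   matrices that are twice a rotation by a right angle in such a plane. *)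
Definition line_plane z (q : 'M[R]_m) := exists a b,
  [/\ dot a a = 1, dot b b = 1, dot a b = 0, z = <[cvec a b]>%VS & q = plane a b].

Lemma mem_cline a b c d :
  reflect (exists s t : R, c = s *: a - t *: b /\ d = t *: a + s *: b)
  (cvec c d \in <[cvec a b]>%VS).
Proof.
apply: (iffP idP) => [/vlineP[[s t]]|[s [t [-> ->]]]].
  by rewrite cvecZ => /cvec_inj[-> ->]; exists s, t.
by apply/vlineP; exists (s +i* t)%C; rewrite cvecZ.
Qed.

Lemma line_plane_fun z q q' : line_plane z q -> line_plane z q' -> q = q'.
Proof.
move=> [a [b [aa bb ab -> ->]]] [c [d [cc dd cd zE ->]]].
have : cvec c d \in <[cvec a b]>%VS by rewrite zE memv_line.
move=> /mem_cline[s [t [cE dE]]].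
have := @plane_cscale _ _ a b s (- t).
rewrite opprK scaleNr -cE -dE => -> //; first by split; rewrite ?aa ?bb.
rewrite mulrNN; have : dot c c = s * s + t * t.
  by rewrite cE !dotL aa bb (dotC b a) ab; ring.
by rewrite cc => <-; rewrite oner_neq0.
Qed.

Lemma line_sub a b c d : dot a a = 1 -> dot b b = 1 -> dot a b = 0 ->
  dot c c = 1 -> dot d d = 1 -> dot c d = 0 ->
  plane a b = plane c d -> cvec c d \in <[cvec a b]>%VS.
Proof.
move=> aa bb ab cc dd cd E; apply/mem_cline.
have Ec : d = dot a c *: b - dot b c *: a.
  by have := planeE a b c; rewrite E planeE aa cc (dotC d c) cd !divr1 scale0r subr0 scale1r.
have Ed : - c = dot a d *: b - dot b d *: a.
  by have := planeE a b d; rewrite E planeE aa cc cd dd !divr1 scale0r sub0r scale1r.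
have ad : dot a d = - dot b c by rewrite {1}Ec !dotL aa ab; ring.
have bd : dot b d = dot a c by rewrite {1}Ec !dotL bb (dotC b a) ab; ring.
exists (dot a c), (- dot b c); split; last by rewrite {1}Ec scaleNr addrC.
by rewrite -[LHS]opprK Ed ad bd opprB !scaleNr.
Qed.

Lemma line_plane_inj z z' q : line_plane z q -> line_plane z' q -> z = z'.
Proof.
move=> [a [b [aa bb ab -> ->]]] [c [d [cc dd cd -> E]]].
by apply/eqP; rewrite eqEsubv -!memvE !line_sub.
Qed.

Lemma line_plane_act g z q : SO g -> line_plane z q ->
  line_plane (act g z) (Ad g q).
Proof.
move=> sg [a [b [aa bb ab -> ->]]]; have og := SO_orth sg.
by exists (g *m a), (g *m b); rewrite !orth_dot // act_line Ad_plane.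
Qed.

Lemma isotropic_line_frame z : \dim z = 1%N -> isotropic z ->
  exists a b, [/\ dot a a = 1, dot b b = 1, dot a b = 0 & z = <[cvec a b]>%VS].
Proof.
move=> dz iz; pose v := vpick z.
have z0 : z != 0%VS by rewrite -dimv_eq0 dz.
have v0 : v != 0 by rewrite vpick0.
have zE : z = <[v]>%VS.
  by apply/esym/eqP; rewrite eqEdim -memvE memv_pick dz dim_vline v0.
have vz : cvec (rpart v) (ipart v) \in z by rewrite -cvecE memv_pick.
have [ab ba] := (isotropicP z).1 iz _ _ _ _ vz vz.
have ab0 : dot (rpart v) (ipart v) = 0 by move: ba; rewrite (dotC (ipart v)); lra.
have a0 : rpart v != 0.
  apply: contra v0 => /eqP a0; have /eqP : dot (ipart v) (ipart v) = 0.
    by rewrite -ab a0 dot0l.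
  by rewrite dot_eq0 => /eqP b0; rewrite [v]cvecE a0 b0 cvec0.
have [c c0 cc] := exists_unit a0.
exists (c *: rpart v), (c *: ipart v); split=> //.
- by move: cc; rewrite !dotL ab.
- by rewrite !dotL ab0 !mulr0.
rewrite zE; apply/esym/eqP.
have -> : cvec (c *: rpart v) (c *: ipart v) = (c +i* 0)%C *: v.
  by rewrite [in RHS](cvecE v) cvecZ !scale0r subr0 add0r.
have cn : (c +i* 0)%C != 0 :> R[i] by rewrite eq_complex /= gt_eqF.
rewrite eqEdim -memvE memvZ ?memv_line //=.
by rewrite !dim_vline scaler_eq0 negb_or cn v0.
Qed.

Lemma isotropic_lines_orbit z0 : (2 < m)%N -> isotropic_lines z0 ->
  @isotropic_lines R m = SO_orbit z0.
Proof.
move=> m2 [d0 i0]; have [a [b [aa bb ab z0E]]] := isotropic_line_frame d0 i0.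
apply/seteqP; split=> [z [dz iz]|_ [g sg <-]].
  have [c [d [cc dd cd ->]]] := isotropic_line_frame dz iz.
  have [||g sg gE] := @frame_SO_transitive R m (1 + 1)
    (row_mx a b) (row_mx c d) m2.
  - exact/frame2.
  - exact/frame2.
  exists g => //; rewrite z0E act_line.
  by move: gE; rewrite mul_mx_row => /eq_row_mx[-> ->].
have og := SO_orth sg; split.
  rewrite z0E act_line dim_vline; case: eqP => // /eqP E.
  move: E; rewrite -cvec0 => /eqP/cvec_inj[g0 _].
  by have := orth_dot a a og; rewrite g0 dot0l aa => /esym/eqP; rewrite oner_eq0.
apply/isotropicP => a1 b1 c1 d1; rewrite !act_cvec // => h1 h2.
have := (isotropicP z0).1 i0 _ _ _ _ h1 h2.
by rewrite !(orth_dot _ _ (orth_tr og)).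
Qed.

(** The realizations are obtained from relations that characterize the matrix of
   a subspace, rather than from formulas for it: equivariance is immediate. *)
Lemma relation_realization (Rel : {vspace vec} -> 'M[R]_m -> Prop) z0 Lam :
  so Lam -> Rel z0 Lam ->
  (forall g z (x : 'M[R]_m), SO g -> Rel z x -> Rel (act g z) (Ad g x)) ->
  (forall z (x y : 'M[R]_m), Rel z x -> Rel z y -> x = y) ->
  (forall z z' (x : 'M[R]_m), Rel z x -> Rel z' x -> z = z') ->
  exists2 f, realization (SO_orbit z0) Lam f &
    forall z (x : 'M[R]_m), Rel z x -> f z = x.
Proof.
move=> sL R0 Ract Rfun Rinj.
pose f z := xget 0 [set x | Rel z x].
have fE z (x : 'M[R]_m) : Rel z x -> f z = x.
  by move=> zx; apply: (Rfun z) => //; apply: (xgetPex 0); exists x.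
exists f => //; split=> //.
  split.
  - move=> _ [g sg <-]; exists g => //; apply/esym/fE; exact: Ract.
  - move=> z z' /set_mem[g sg <-] /set_mem[h sh <-].
    rewrite (fE _ _ (Ract _ _ _ sg R0)) (fE _ _ (Ract _ _ _ sh R0)) => E.
    apply: (Rinj _ _ (Ad g Lam)); first exact: Ract.
    by rewrite E; apply: Ract.
  - move=> _ [g sg <-]; exists (act g z0); first by exists g.
    by apply: fE; apply: Ract.
move=> g _ sg [h sh <-].
by rewrite (fE _ _ (Ract _ _ _ sg (Ract _ _ _ sh R0))) (fE _ _ (Ract _ _ _ sh R0)).
Qed.

End ComplexVectors.

(** * Isotropic pairs *)

Section FlagPair.
Variables (R : realType) (m : nat).
Local Notation vec := 'cV[R[i]]_m.
Local Notation conjmx := Pilot.Defs.conjmx.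
Local Notation orthogonal := Pilot.Defs.orthogonal.
Variables (x y : {vspace vec}) (J : 'M[R]_m) (a b : 'cV[R]_m).
Hypotheses (cJ : cstruct J) (eJ : i_eigenspace J (x + y)%VS)
  (aa : dot a a = 1) (bb : dot b b = 1) (ab : dot a b = 0)
  (xE : x = <[cvec a b]>%VS) (xy : orthogonal x y) (iz : isotropic (x + y)%VS).
Let Q := cline J a.

Lemma pair_Ja : J *m a = - b /\ J *m b = a.
Proof.
apply/eJ; rewrite -[cvec a b]addr0; apply: memv_add; last exact: mem0v.
by rewrite xE memv_line.
Qed.

Lemma pair_QE v : Q *m v = dot a v *: a + dot b v *: b.
Proof.
rewrite clineE /cscale aa !divr1 pair_Ja.1 dotNl scalerN scaleNr opprK //.
Qed.

Lemma pair_plane : plane a b = (- 2) *: (J *m Q).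
Proof.
apply: eq_mulcv => v; rewrite -!scalemxAl -mulmxA pair_QE mulmxDr -!scalemxAr.
rewrite pair_Ja.1 pair_Ja.2 /plane aa divr1 mulmxBl !rank1_mul.
by apply/matrixP => i j; rewrite !mxE; ring.
Qed.

Lemma pair_y_perp c d : cvec c d \in y ->
  [/\ dot a c = 0, dot a d = 0, dot b c = 0 & dot b d = 0].
Proof.
move=> cdy; have abx : cvec a b \in x by rewrite xE memv_line.
have [e1 e2] := (cvec_herm0 a b c d).1 (xy abx cdy).
have abz : cvec a b \in (x + y)%VS.
  by rewrite -[cvec a b]addr0; apply: memv_add => //; exact: mem0v.
have cdz : cvec c d \in (x + y)%VS.
  by rewrite -[cvec c d]add0r; apply: memv_add => //; exact: mem0v.
have [e3 e4] := (isotropicP _).1 iz _ _ _ _ abz cdz.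
by split; lra.
Qed.

(** On x the matrices J2 = 2 JQ - J and J agree, whereas J2 = - J on the
   orthogonal of x and x^*, where Q vanishes, so that y^* takes the place of y.
   Conversely, Q splits an eigenvector of J2 into its components in x and y^*. *)
Lemma pair_eig2 : i_eigenspace (2 *: (J *m Q) - J) (x + conjv y)%VS.
Proof.
have [Ja Jb] := pair_Ja; have [Jt JJ] := cJ.
have J2 v : (2 *: (J *m Q) - J) *m v =
    2 *: (- dot a v *: b + dot b v *: a) - J *m v.
  rewrite mulmxBl -scalemxAl -mulmxA pair_QE mulmxDr -!scalemxAr Ja Jb.
  by rewrite scalerN scaleNr.
move=> c d; split.
  case/memv_addP => u; rewrite xE [u]cvecE => /mem_cline[s [t [-> ->]]] [v].
  rewrite memv_conjv [v]cvecE conj_cvec => vy.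
  have [e1 e2 e3 e4] := pair_y_perp vy.
  have vz : cvec (rpart v) (- ipart v) \in (x + y)%VS.
    by rewrite -[cvec _ _]add0r; apply: memv_add => //; exact: mem0v.
  have [+ +] := (eJ _ _).1 vz.
  rewrite opprK mulmxN => J1 J3.
  have {}e2 : dot a (ipart v) = 0 by move: e2; rewrite dotNr; lra.
  have {}e4 : dot b (ipart v) = 0 by move: e4; rewrite dotNr; lra.
  rewrite cvecD => /cvec_inj[-> ->].
  rewrite !J2 !mulmxDr !mulmxN -!scalemxAr Ja Jb J1.
  have -> : J *m ipart v = - rpart v by rewrite -J3 opprK.
  rewrite !dotL aa bb ab (dotC b a) ab e1 e2 e3 e4.
  by split; apply/matrixP => i j; rewrite !mxE; ring.
move=> [E1 E2].
pose c1 := dot a c *: a + dot b c *: b; pose d1 := dot a d *: a + dot b d *: b.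
have ad : dot a d = - dot b c.
  have := congr1 (dot a) E1; rewrite J2 !dotL aa ab.
  have -> : dot a (J *m c) = dot b c.
    by rewrite -[J]opprK mulNmx dotNr -Jt -dot_mull Ja dotNl opprK.
  by lra.
have bd : dot b d = dot a c.
  have := congr1 (dot b) E1; rewrite J2 !dotL bb (dotC b a) ab.
  have -> : dot b (J *m c) = - dot a c.
    by rewrite -[J]opprK mulNmx dotNr -Jt -dot_mull Jb.
  by lra.
have x1 : cvec c1 d1 \in x.
  rewrite xE; apply/mem_cline; exists (dot a c), (- dot b c).
  by rewrite scaleNr opprK /d1 ad bd.
have z2 : cvec (c - c1) (- (d - d1)) \in (x + y)%VS.
  have E1' : J *m c = 2 *: (- dot a c *: b + dot b c *: a) + d.
    by rewrite -[d]opprK -E1 J2 opprB addrC subrK.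
  have E : J *m (c - c1) = - - (d - d1).
    rewrite mulmxBr E1' /c1 mulmxDr -!scalemxAr Ja Jb /d1 ad bd.
    by apply/matrixP => i j; rewrite !mxE; ring.
  apply/eJ; split => //.
  by rewrite -[- (d - d1)]opprK -E mulmxN mulmxA JJ mulNmx mul1mx opprK.
case/memv_addP: z2 => u; rewrite {1}xE [u]cvecE => /mem_cline[s [t [us ut]]] [v vy].
rewrite [v]cvecE cvecD => /cvec_inj[cE dE].
have := vy; rewrite [v]cvecE => /pair_y_perp[v1 v2 v3 v4].
have proj0 (w : 'cV[R]_m) : dot a (w - (dot a w *: a + dot b w *: b)) = 0 /\
    dot b (w - (dot a w *: a + dot b w *: b)) = 0.
  by rewrite !dotL aa bb ab (dotC b a) ab; split; ring.
have s0 : s = 0.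
  have := congr1 (dot a) cE; rewrite (proj0 c).1 us !dotL aa ab v1.
  lra.
have t0 : t = 0.
  have := congr1 (dot b) cE; rewrite (proj0 c).2 us !dotL bb (dotC b a) ab v3.
  lra.
have u0 : rpart u = 0 /\ ipart u = 0.
  by rewrite us ut s0 t0 !scale0r subr0 addr0.
have y2 : cvec (c - c1) (d - d1) \in conjv y.
  rewrite memv_conjv conj_cvec cE dE u0.1 u0.2 !add0r -cvecE; exact: vy.
have -> : cvec c d = cvec c1 d1 + cvec (c - c1) (d - d1).
  by rewrite cvecD ![_ + (_ - _)]addrC !subrK.
exact: memv_add.
Qed.

End FlagPair.

Section FlagMap.
Variables (R : realType) (m : nat).
Local Notation vec := 'cV[R[i]]_m.
Local Notation conjmx := Pilot.Defs.conjmx.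
Local Notation orthogonal := Pilot.Defs.orthogonal.
Implicit Types (x y : {vspace vec}) (g : 'M[R]_m).

Lemma act_orthogonal g x y : SO g -> orthogonal x y ->
  orthogonal (act g x) (act g y).
Proof.
move=> sg xy u v; rewrite [u]cvecE [v]cvecE !act_cvec // => ux vy.
have := xy _ _ ux vy => /cvec_herm0.
have og := orth_tr (SO_orth sg).
by rewrite !(orth_dot _ _ og) => /cvec_herm0.
Qed.

Lemma flag_map_act g x y : SO g ->
  flag_map (act g x, act g y) =
  (act g (x + y)%VS, act g (x + conjv y)%VS, act g x).
Proof. by move=> sg; rewrite /flag_map /= !actD act_conjv. Qed.

(** Hence x and x + y determine y: its vectors are the vectors of x + y that are
   orthogonal to x. *)
Lemma orthogonal_sum_sub x y y' : orthogonal x y -> orthogonal x y' ->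
  (x + y = x + y')%VS -> (y <= y')%VS.
Proof.
move=> xy xy' E; apply/subvP => v vy.
have : v \in (x + y')%VS.
  by rewrite -E -[v]add0r; apply: memv_add => //; exact: mem0v.
case/memv_addP => v1 v1x [v2 v2y vE].
suff v10 : v1 = 0 by rewrite vE v10 add0r.
have : (conjmx v1)^T *m v1 = 0.
  have -> : v1 = v - v2 by rewrite vE addrK.
  rewrite mulmxBr (_ : v - v2 = v1); last by rewrite vE addrK.
  by rewrite xy // xy' // subrr.
rewrite [v1]cvecE => /cvec_herm0[e _].
have h1 := dot_ge0 (rpart v1); have h2 := dot_ge0 (ipart v1).
have /eqP : dot (rpart v1) (rpart v1) = 0 by lra.
have /eqP : dot (ipart v1) (ipart v1) = 0 by lra.
by rewrite !dot_eq0 => /eqP -> /eqP ->; rewrite cvec0.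
Qed.

Lemma flag_map_inj x y : orthogonal x y ->
  set_inj (SO_orbit2 (x, y)) (@flag_map R m).
Proof.
move=> xy _ _ /set_mem[g sg <-] /set_mem[h sh <-] E.
have E1 : (act g x + act g y = act h x + act h y)%VS.
  exact: (congr1 (fun t => t.1.1) E).
have E3 : act g x = act h x by exact: (congr1 snd E).
have og := act_orthogonal sg xy; have oh := act_orthogonal sh xy.
rewrite E3 in E1 og *; congr (_, _).
by apply/eqP; rewrite eqEsubv (orthogonal_sum_sub og oh E1)
  (orthogonal_sum_sub oh og (esym E1)).
Qed.

End FlagMap.

(** * The Lagrangian embedding *)

Theorem proposition4 (R : realType) (n : nat) (hn : (2 <= n)%N)
    (x0 y0 : {vspace 'cV[R[i]]_(2 * n)}) (h0 : isotropic_pair x0 y0) :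
  let P := SO_orbit2 (x0, y0) in
  let F1 := SO_orbit (x0 + y0)%VS in
  let F2 := SO_orbit (x0 + conjv y0)%VS in
  let F3 := @isotropic_lines R (2 * n) in
  [/\ set_fun P (F1 `*` F2 `*` F3) (@flag_map R (2 * n)),
      set_inj P (@flag_map R (2 * n)) &
      exists Lam1 Lam2 Lam3 : 'M[R]_(2 * n),
      exists f1 f2 f3 : {vspace 'cV[R[i]]_(2 * n)} -> 'M[R]_(2 * n),
        [/\ realization F1 Lam1 f1, realization F2 Lam2 f2,
            realization F3 Lam3 f3 &
            lagrangian (@kks3 R (2 * n))
              (adjoint_orbit Lam1 `*` adjoint_orbit Lam2 `*` adjoint_orbit Lam3)
              [set (f1 z.1.1, f2 z.1.2, f3 z.2)
                 | z in @flag_map R (2 * n) @` P]]].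
Proof.
case: n hn x0 y0 h0 => [//|n] hn x0 y0 [[dx ix] [dy iy] xy [_ dz iz]] P F1 F2 F3.
have mE : (2 * n.+1 = n.+1 + n.+1)%N by rewrite mul2n addnn.
have [J [cJ eJ]] := isotropic_complex_structure mE dz iz.
have [a [b [aa bb ab xE]]] := isotropic_line_frame dx ix.
have F3E : F3 = SO_orbit x0.
  by apply: isotropic_lines_orbit; [rewrite mE; lia|split].
pose Q := cline J a.
have eJ2 := pair_eig2 cJ eJ aa bb ab xE xy iz.
have plE := pair_plane eJ aa xE.
have pp := cline_proj cJ aa.
set J2 := 2 *: (J *m cline J a) - J in eJ2.
have cJ2 : cstruct J2 := proj_pair_cstruct pp.
pose RelJ z (K : 'M[R]_(2 * n.+1)) := cstruct K /\ i_eigenspace K z.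
have RelJ_act g z K : SO g -> RelJ z K -> RelJ (act g z) (Ad g K).
  by move=> sg [cK eK]; split; [exact: Ad_cstruct|exact: eig_act].
have RelJ_fun z K K' : RelJ z K -> RelJ z K' -> K = K'.
  by move=> [cK eK] [_ eK']; exact: eig_fun eK eK'.
have RelJ_inj z z' K : RelJ z K -> RelJ z' K -> z = z'.
  by move=> [_ eK] [_ eK']; exact: eig_inj eK eK'.
have [f1 real1 f1E] := relation_realization (Rel := RelJ) cJ.1 (conj cJ eJ)
  RelJ_act RelJ_fun RelJ_inj.
have [f2 real2 f2E] := relation_realization (Rel := RelJ) cJ2.1 (conj cJ2 eJ2)
  RelJ_act RelJ_fun RelJ_inj.
have lp0 : line_plane x0 (plane a b) by exists a, b.
have so3 : so (plane a b).
  by rewrite /so /= linearZ /= linearB /= !trmx_mul !trmxK -scalerN opprB.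
have [f3 real3 f3E] := relation_realization so3 lp0 (@line_plane_act R _)
  (@line_plane_fun R _) (@line_plane_inj R _).
have LE : [set (f1 z.1.1, f2 z.1.2, f3 z.2) | z in @flag_map R (2 * n.+1) @` P] =
    flag_orbit J (cline J a).
  have E g : SO g -> let z := flag_map (act g x0, act g y0) in
      (f1 z.1.1, f2 z.1.2, f3 z.2) = Ad3 g (triple J (cline J a)).
    move=> sg; rewrite flag_map_act //= /Ad3 /triple /= -plE.
    rewrite (f1E _ _ (RelJ_act _ _ _ sg (conj cJ eJ))).
    rewrite (f2E _ _ (RelJ_act _ _ _ sg (conj cJ2 eJ2))).
    by rewrite (f3E _ _ (line_plane_act sg lp0)).
  apply/seteqP; split=> [_ [_ [_ [g sg <-] <-] <-]|_ [g sg <-]].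
    by rewrite E //; exists g.
  rewrite -E //; eexists; last by [].
  by eexists; last by []; exists g.
split.
- move=> _ [g sg <-]; rewrite F3E flag_map_act //.
  by split; [split|]; exists g.
- exact: flag_map_inj xy.
exists J, J2, (plane a b), f1, f2, f3; split=> //; first by rewrite F3E.
rewrite LE; split; last split.
- move=> _ [g sg <-]; rewrite /Ad3 /triple /= -plE.
  by split; [split|]; exists g.
- exists (n.+1 * n + (n + n))%N, ((n.+1 * n + n.+1 * n) + ((n + n) + (n + n)))%N.
  split; last by lia.
    exact: submanifold_triple.
  apply: submanifold_prod; first by apply: submanifold_prod; exact: submanifold_cstruct.
  by apply: submanifold_plane => //; lia.
- by move=> p u v; exact: flag_kks.
Qed.
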